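(* Let $\alpha\in(0,1)$, $\sigma=1-\alpha/2$, and let $\Omega\subset\mathbb R^d$ be a bounded Lipschitz domain. Let $0=t_0<t_1<t_2<\cdots$ be a time mesh with steps $\tau_j=t_j-t_{j-1}$ and step ratios $\rho_j=\tau_j/\tau_{j-1}$ ($j\ge 2$), and suppose that for every $k\ge 2$: $$\rho_*<\rho_{k+1}\le \frac{\rho_k^2(1+\rho_k)}{1-3\rho_k^2(1+\rho_k)}\ \text{ if } \rho_*<\rho_k<\eta,\qquad \rho_*<\rho_{k+1}\ \text{ if } \eta\le\rho_k,$$ (in particular $\rho_k>\rho_*$ for all $k\ge2$), where $\rho_*$ and $\eta$ are as defined in the context. Then for every sequence $u=(u^0,u^1,u^2,\dots)$ of functions in $L^2(\Omega)$ and every $n\ge 1$, $$\mathcal B_n(u,u):=\sum_{k=1}^n\langle L_k^{\alpha,*}u,\delta_k u\rangle\ \ge\ \sum_{k=1}^n\frac{g_k(\alpha)}{2\Gamma(2-\alpha)}\|\delta_k u\|_{L^2(\Omega)}^2\ \ge 0,$$ where $\langle\cdot,\cdot\rangle$ is the $L^2(\Omega)$ inner product and $$g_k(\alpha)=\begin{cases}\dfrac{1}{(\sigma\tau_1)^\alpha}\Big(2\sigma-\dfrac{1-\alpha}{\rho_2^\alpha}\Big), & k=1,\\[2mm] (1-\alpha)c_{k-1}^k+\dfrac{1}{(\sigma\tau_k)^\alpha}\Big(1-\dfrac{\alpha(1-\alpha)}{(1+\rho_{k+1})\rho_{k+1}^\alpha}\displaystyle\int_0^1\frac{s(\rho_{k+1}+s)}{\sigma\rho_{k+1}+s}\,\mathrm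 ds\Big), & 2\le k\le n-1,\\[2mm] (1-\alpha)c_{n-1}^n+\dfrac{1}{(\sigma\tau_n)^\alpha}, & k=n\neq 2.\end{cases}$$ Moreover, these $g_k(\alpha)$ are positive for all $\alpha\in(0,1)$.
   Context: Notation: $t_k^*=t_{k-1}+\sigma\tau_k$. For $k\ge2$ and $1\le j\le k-1$ define $$a_j^k=\int_0^1\frac{-2\tau_j(1-\theta)-\tau_{j+1}}{(\tau_j+\tau_{j+1})\,(t_k^*-t_{j-1}-\theta\tau_j)^\alpha}\,\mathrm d\theta,\qquad c_j^k=\int_0^1\frac{\tau_j^2(2\theta-1)}{\tau_{j+1}(\tau_j+\tau_{j+1})\,(t_k^*-t_{j-1}-\theta\tau_j)^\alpha}\,\mathrm d\theta,$$ and $d_j^k=c_{j-1}^k-a_j^k$ for $2\le j\le k-1$; by convention $a_1^1=0$, $c_0^1=0$. For a sequence $u=(u^0,u^1,\dots)$ set $\delta_j u=u^j-u^{j-1}$ and define the L2-1$_\sigma$ discrete fractional derivative, for $k\ge1$, $$L_k^{\alpha,*}u=\frac{1}{\Gamma(1-\alpha)}\Big(c_{k-1}^k\delta_k u-a_1^k\delta_1u+\sum_{j=2}^{k-1}d_j^k\delta_j u\Big)+\frac{\sigma^{1-\alpha}}{\Gamma(2-\alpha)\tau_k^\alpha}\delta_k u.$$ $\rho_*\approx 0.356341$ is the unique positive root of $\rho(1+\rho)=1-3\rho^2(1+\rho)$, and $\eta\approx0.475329$ is the unique positive root of $1-3\rho^2(1+\rho)=0$.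
   Formalization: The condition ''k = n ≠ 2'' in the last case of g_k(α) is read as ''k = n ≠ 1'': as printed, g_2 is undefined for n = 2 and g_1 has two conflicting values for n = 1. L²(Ω) is generalized to an arbitrary real inner product space. *)

(* Defs.v *)
From HB Require Import structures.
From mathcomp Require Import all_boot all_order all_algebra.
From mathcomp Require Import all_classical all_reals all_analysis.
Set Implicit Arguments. Unset Strict Implicit. Unset Printing Implicit Defensive.
Import Order.TTheory GRing.Theory Num.Theory.
Import numFieldNormedType.Exports.
Local Open Scope ring_scope.

Section L21sigma.
Variable R : realType.

Definition is_inner_product (V : lmodType R) (ip : V -> V -> R) : Prop :=
  [/\ forall x y, ip x y = ip y x,
      forall (a : R) x y z, ip (a *: x + y) z = a * ip x z + ip y z,
      forall x, 0 <= ip x x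
    & forall x, ip x x = 0 -> x = 0].

Definition Gamma (s : R) : R :=
  \int[lebesgue_measure]_(x in `]0%R, +oo[%classic) (x `^ (s - 1) * expR (- x)).

Definition sig (alpha : R) : R := 1 - alpha / 2.

Definition tau (t : nat -> R) (j : nat) : R := t j - t j.-1.

Definition rho (t : nat -> R) (j : nat) : R := tau t j / tau t j.-1.

Definition tstar (alpha : R) (t : nat -> R) (k : nat) : R :=
  t k.-1 + sig alpha * tau t k.

Definition acoef (alpha : R) (t : nat -> R) (k j : nat) : R :=
  if (0 < j < k)%N then
    \int[lebesgue_measure]_(th in `[0%R, 1%R]%classic)
      ((- 2 * tau t j * (1 - th) - tau t j.+1) /
       ((tau t j + tau t j.+1) *
        (tstar alpha t k - t j.-1 - th * tau t j) `^ alpha))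
  else 0.

Definition ccoef (alpha : R) (t : nat -> R) (k j : nat) : R :=
  if (0 < j < k)%N then
    \int[lebesgue_measure]_(th in `[0%R, 1%R]%classic)
      (tau t j ^+ 2 * (2 * th - 1) /
       (tau t j.+1 * (tau t j + tau t j.+1) *
        (tstar alpha t k - t j.-1 - th * tau t j) `^ alpha))
  else 0.

Definition dcoef (alpha : R) (t : nat -> R) (k j : nat) : R :=
  ccoef alpha t k j.-1 - acoef alpha t k j.

Definition delta (V : lmodType R) (u : nat -> V) (j : nat) : V := u j - u j.-1.

Definition Lstar (V : lmodType R) (alpha : R) (t : nat -> R) (u : nat -> V)
    (k : nat) : V :=
  (Gamma (1 - alpha))^-1 *:
    (ccoef alpha t k k.-1 *: delta u k - acoef alpha t k 1 *: delta u 1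
     + \sum_(2 <= j < k) dcoef alpha t k j *: delta u j)
  + (sig alpha `^ (1 - alpha) / (Gamma (2 - alpha) * tau t k `^ alpha))
      *: delta u k.

Definition Bn (V : lmodType R) (ip : V -> V -> R) (alpha : R) (t : nat -> R)
    (u : nat -> V) (n : nat) : R :=
  \sum_(1 <= k < n.+1) ip (Lstar alpha t u k) (delta u k).

Definition gcoef (alpha : R) (t : nat -> R) (n k : nat) : R :=
  if k == 1%N then
    ((sig alpha * tau t 1) `^ alpha)^-1 *
      (2 * sig alpha - (1 - alpha) / rho t 2 `^ alpha)
  else if k == n then
    (1 - alpha) * ccoef alpha t k k.-1 + ((sig alpha * tau t k) `^ alpha)^-1
  else
    (1 - alpha) * ccoef alpha t k k.-1 +
      ((sig alpha * tau t k) `^ alpha)^-1 *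
      (1 - alpha * (1 - alpha) /
             ((1 + rho t k.+1) * rho t k.+1 `^ alpha) *
           \int[lebesgue_measure]_(s in `[0%R, 1%R]%classic)
              (s * (rho t k.+1 + s) / (sig alpha * rho t k.+1 + s))).

End L21sigma.

(* Main.v *)
(* After multiplication by 2 Gamma(2 - alpha), which equals
   2 (1 - alpha) Gamma(1 - alpha), the difference of the two sides becomes a
   quadratic form in the delta_k u.  Two Abel summations write this form as a
   combination of the squared norms |delta_i u + ... + delta_m u|^2 whose
   weights are mixed second differences of the coefficients, so it suffices
   that these weights are nonnegative.  On each subinterval the coefficients
   are integrals of the kernel (t_k^* - s)^(-alpha), or of the difference of
   two consecutive kernels, and both functions are convex and nondecreasing in
   s.  Comparing the kernel with its tangent at the common node of two adjacent
   subintervals reduces nonnegativity of a weight to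
   1 / (rho_j^2 (1 + rho_j)) <= 3 + 1 / rho_{j+1}, which is exactly what the mesh
   condition says.  The weights with i = m < n carry in addition the integral
   term of g_m, which dominates the missing contribution of one subinterval
   after an integration by parts. *)
Require Import Defs.
From HB Require Import structures.
From mathcomp Require Import all_boot all_order all_algebra.
From mathcomp Require Import all_classical all_reals all_analysis.
From mathcomp Require Import measurable_realfun ring lra.
Import Order.TTheory GRing.Theory Num.Theory.
Import numFieldNormedType.Exports.
Local Open Scope ring_scope.

Set Implicit Arguments. Unset Strict Implicit. Unset Printing Implicit Defensive.

(** * The functional equation of Gamma *)

(** Stated with a right limit of [F] at [a], since near 0 the factor [x^(b-1)] of the integrand of
    [Gamma] is unbounded for [b < 1]. Monotone convergence along the half-lines from [a + 1/(n+1)]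
    reduces it to the closed case. *)
Lemma ge0_continuous_FTC2oy (R : realType) (f F : R -> R) (a l0 l : R) :
  (forall x, a < x -> 0 <= f x) ->
  (forall x, a < x -> {for x, continuous f}) ->
  (forall x, a < x -> is_derive x 1 F (f x)) ->
  (F x @[x --> a^'+] --> l0)%classic -> (F x @[x --> +oo] --> l)%classic ->
  (\int[lebesgue_measure]_(x in `]a, +oo[%classic) (f x)%:E = (l - l0)%:E)%E.
Proof.
move=> f0 fc dF Fa Fl.
pose e (n : nat) : R := a + n.+1%:R^-1.
have ea n : a < e n by rewrite /e ltrDl invr_gt0 ltr0n.
pose A (n : nat) := `[e n, +oo[%classic : set R.
have UA : (\bigcup_n A n)%classic = `]a, +oo[%classic.
  rewrite eqEsubset; split => x /=.
    move=> [n _]; rewrite /A /= !in_itv/= !andbT; exact: lt_le_trans.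
  rewrite in_itv/= andbT => ax.
  have xa0 : 0 < x - a by rewrite subr_gt0.
  exists (Num.truncn ((x - a)^-1)) => //; rewrite /A/= in_itv/= andbT /e.
  rewrite -lerBrDl invf_ple ?posrE ?ltr0n//.
  by apply/ltW; rewrite truncnS_gt.
have mA n : measurable (A n) by exact: measurable_itv.
have mf : measurable_fun `]a, +oo[%classic f.
  apply: open_continuous_measurable_fun => // x.
  by rewrite inE/= in_itv/= andbT => /fc.
have H := @ge0_nondecreasing_set_cvg_integral _ (measurableTypeR R) R A (EFin \o f) lebesgue_measure.
rewrite UA in H.
have H1 : (\int[lebesgue_measure]_(x in A i) (EFin \o f) x @[i --> \oo]
    --> \int[lebesgue_measure]_(x in `]a, +oo[) (EFin \o f) x)%E%classic.
  apply: H => //.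
  - move=> n m nm; apply/subsetPset => x; rewrite /A/= !in_itv/= !andbT.
    apply: le_trans; rewrite lerD2l lef_pV2 ?posrE ?ltr0n// ler_nat.
    by rewrite ltnS.
  - move=> n; apply/measurable_EFinP; apply: measurable_funS mf => //.
    by rewrite -UA; exact: bigcup_sup.
  - move=> n x; rewrite /A/= in_itv/= andbT => enx; rewrite lee_fin f0//.
    exact: lt_le_trans enx.
have H2 n : (\int[lebesgue_measure]_(x in A n) (EFin \o f) x = (l - F (e n))%:E)%E.
  rewrite (@ge0_continuous_FTC2y R f F (e n) l)//.
  - by move=> x ex; rewrite f0// (lt_le_trans _ ex).
  - apply: continuous_in_subspaceT => x; rewrite inE/= in_itv/= andbT => ex.
    by apply: fc; rewrite (lt_le_trans _ ex).
  - by move=> x ex; have [] := dF x (lt_trans (ea n) ex).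
  - apply: cvg_at_right_filter.
    apply/differentiable_continuous/derivable1_diffP.
    by have [] := dF _ (ea n).
  - move=> x; rewrite in_itv/= andbT => ex.
    by rewrite derive1E; have [] := dF x (lt_trans (ea n) ex).
have {}H1 : ((l - F (e n))%:E @[n --> \oo]
    --> \int[lebesgue_measure]_(x in `]a, +oo[) (EFin \o f) x)%E%classic.
  by apply: cvg_trans H1; apply: near_eq_cvg; apply: nearW => n; rewrite -H2.
have H3 : ((l - F (e n))%:E @[n --> \oo] --> (l - l0)%:E)%classic.
  apply: cvg_EFin; first exact: nearW.
  apply: cvgB; first exact: cvg_cst.
  move/cvg_at_rightP : Fa; apply; split => //.
  rewrite -[X in (_ --> X)%classic]addr0; apply: cvgD; first exact: cvg_cst.
  exact: cvg_harmonic.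
by apply: (cvg_unique _ H1 H3); exact: ereal_hausdorff.
Qed.

Lemma is_derive_powR_expRN (R : realType) (p c x : R) : 0 < x ->
  is_derive x 1 (fun y : R => y `^ p * expR (- (c * y)))
    (p * x `^ (p - 1) * expR (- (c * x)) - c * (x `^ p * expR (- (c * x)))).
Proof.
move=> x0; have dp := is_derive1_powR p x0.
have de : is_derive x 1 (expR \o (fun y : R => - (c * y))) (expR (- (c * x)) * - c).
  apply: is_derive1_comp; apply: is_derive_eq.
  by rewrite -[LHS]/(- (c * 1)) mulr1.
apply: (is_derive_eq (is_deriveM dp de)).
rewrite -[LHS]/(x `^ p * (expR (- (c * x)) * - c) +
  expR (- (c * x)) * (p * x `^ (p - 1))); ring.
Qed.

Lemma continuous_powR_expRN (R : realType) (p x : R) : 0 < x ->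
  {for x, continuous (fun y : R => y `^ p * expR (- y))}.
Proof.
move=> x0; have -> : (fun y : R => y `^ p * expR (- y)) =
    (fun y : R => y `^ p * expR (- (1 * y))) by apply/funext => y; rewrite mul1r.
have [+ _] := is_derive_powR_expRN p 1 x0.
by move=> /derivable1_diffP/differentiable_continuous.
Qed.

(** From [x^p <= 1 + x <= 2 (1 + x/2)]. Hence [x^b e^(-x)] is dominated by [2 e^(-x/2)]. *)
Lemma powR_le_expR (R : realType) (p x : R) : 0 <= p <= 1 -> 0 <= x ->
  x `^ p <= 2 * expR (x / 2).
Proof.
move=> /andP[p0 p1] x0; have := expR_ge1Dx (x / 2).
suff : x `^ p <= 1 + x by lra.
have [x1|x1] := leP 1 x; first by rewrite (le_trans (ler1_powR x1 p1)) ?lerDr.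
by rewrite -[leLHS]addr0 lerD// (le_trans (ge0_ler_powR p0 _ _ (ltW x1))) ?nnegrE ?powR1.
Qed.

(** Integration by parts: [x^b e^(-x)] vanishes at 0 and at infinity. It is applied with
    [b = 1 - alpha]. *)
Lemma GammaS (R : realType) (b : R) : 0 < b <= 1 ->
  Gamma (b + 1) = b * Gamma b /\ 0 < Gamma (b + 1).
Proof.
move=> /andP[b0 b1].
(* [J - 2 * E] is a primitive of [P + (E - J)], a sum of nonnegative functions,
   so that no integrability has to be known in advance. *)
pose P (x : R) := b * (x `^ (b - 1) * expR (- x)).
pose J (x : R) := x `^ b * expR (- x).
pose E (x : R) := 2 * expR (- (2^-1 * x)).
have P0 x : 0 <= P x by rewrite !mulr_ge0 ?expR_ge0 ?powR_ge0// ltW.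
have J0 x : 0 <= J x by rewrite !mulr_ge0 ?expR_ge0 ?powR_ge0// ltW.
have JE x : 0 <= x -> J x <= E x.
  move=> x0; rewrite /J /E.
  have -> : - x = - (2^-1 * x) - x / 2 by field.
  rewrite expRD mulrCA [leRHS]mulrC ler_pM2l ?expR_gt0//.
  by rewrite expRN ler_pdivrMr ?expR_gt0// powR_le_expR// b1 ltW.
have dJ (x : R) : 0 < x -> is_derive x 1 J (P x - J x).
  move=> x0; have := is_derive_powR_expRN b 1 x0.
  rewrite /J /P !mul1r mulrA; by under eq_fun do rewrite mul1r.
have dE (x : R) : is_derive x 1 (fun y => - (2 * E y)) (E x).
  have de : is_derive x 1 (expR \o (fun y : R => - (2^-1 * y)))
      (expR (- (2^-1 * x)) * - 2^-1).
    apply: is_derive1_comp; apply: is_derive_eq.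
    by rewrite -[LHS]/(- (2^-1 * 1)) mulr1.
  rewrite /E; apply: is_derive_eq.
  rewrite -[LHS]/(- (2 * (2 * (expR (- (2^-1 * x)) * - 2^-1)))); by field.
have cE : continuous E.
  move=> x; apply: cvgM; first exact: cvg_cst.
  apply: continuous_comp; last exact: continuous_expR.
  by apply: cvgN; apply: cvgM; [exact: cvg_cst|exact: cvg_id].
have cJ x : 0 < x -> {for x, continuous J}.
  exact: continuous_powR_expRN.
have cP x : 0 < x -> {for x, continuous P}.
  by move=> x0; apply: cvgM; [exact: cvg_cst|exact: continuous_powR_expRN].
have limE : (E x @[x --> +oo] --> (0 : R))%classic.
  rewrite -(mulr0 2); apply: cvgM; first exact: cvg_cst.
  apply: (@cvg_comp _ _ _ (fun x : R => 2^-1 * x) (fun x : R => expR (- x)) _ (+oo)%R).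
    by apply: gt0_cvgMry => //; exact: cvg_id.
  exact: cvgr_expR.
have E0 : (E x @[x --> 0^'+] --> (2 : R))%classic.
  have -> : 2 = E 0 by rewrite /E mulr0 oppr0 expR0 mulr1.
  exact/cvg_at_right_filter/cE.
have J00 : (J x @[x --> 0^'+] --> (0 : R))%classic.
  suff : (J x @[x --> 0^'+] --> 0 * expR (- 0))%classic by rewrite mul0r.
  apply: cvgM; first exact: powR_cvg0.
  apply: cvg_at_right_filter; apply: continuous_comp; last exact: continuous_expR.
  exact: oppr_continuous.
have limJ : (J x @[x --> +oo] --> (0 : R))%classic.
  apply: (squeeze_cvgr _ (cvg_cst 0) limE).
  by near=> x; rewrite J0 JE//; near: x; exact: nbhs_pinfty_ge.
set mu := @lebesgue_measure R.
have IE : (\int[mu]_(x in `]0%R, +oo[%classic) (E x)%:E = 4%:E)%E.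
  rewrite (@ge0_continuous_FTC2oy _ E (fun y => - (2 * E y)) 0 (- (2 * 2)) (- (2 * 0)))//.
  - congr EFin; ring.
  - by move=> x _; rewrite mulr_ge0 ?expR_ge0.
  - by move=> x _; exact: cE.
  - by apply: cvgN; apply: cvgM => //; exact: cvg_cst.
  - by apply: cvgN; apply: cvgM => //; exact: cvg_cst.
have IPE : (\int[mu]_(x in `]0%R, +oo[%classic) (P x + (E x - J x))%:E = 4%:E)%E.
  rewrite -[RHS]/(4%:E); have -> : 4 = 0 - 2 * 0 - (0 - 2 * 2) :> R by ring.
  apply: (@ge0_continuous_FTC2oy _ _ (fun y => J y - 2 * E y)).
  - by move=> x x0; rewrite addr_ge0// subr_ge0 JE// ltW.
  - by move=> x x0; apply: cvgD; [exact: cP|apply: cvgB; [exact: cE|exact: cJ]].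
  - move=> x x0; have := dJ x x0; have := dE x => d1 d2.
    apply: (is_derive_eq (is_deriveD d2 d1)).
    by rewrite -[LHS]/(P x - J x + E x); ring.
  - by apply: cvgB => //; apply: cvgM => //; exact: cvg_cst.
  - by apply: cvgB => //; apply: cvgM => //; exact: cvg_cst.
have mcont (f : R -> R) : (forall x, 0 < x -> {for x, continuous f}) ->
    measurable_fun (`]0%R, +oo[%classic : set R) (EFin \o f).
  move=> cf; apply/measurable_EFinP; apply: open_continuous_measurable_fun => // x.
  by rewrite inE/= in_itv/= andbT => /cf.
have cEJ x : 0 < x -> {for x, continuous (fun y => E y - J y)}.
  by move=> x0; apply: cvgB; [exact: cE|exact: cJ].
have D0 x : (`]0%R, +oo[%classic : set R) x -> 0 < x by rewrite /= in_itv/= andbT.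
have EJ0 x : (`]0%R, +oo[%classic : set R) x -> (0 <= (E x - J x)%:E)%E.
  by move=> /D0 x0; rewrite lee_fin subr_ge0 JE// ltW.
have S1 : (\int[mu]_(x in `]0%R, +oo[%classic) (P x)%:E +
    \int[mu]_(x in `]0%R, +oo[%classic) (E x - J x)%:E = 4%:E)%E.
  rewrite -IPE; under [RHS]eq_integral do rewrite EFinD.
  rewrite ge0_integralD//; first by move=> x _; rewrite lee_fin.
  - exact: mcont.
  - exact: (mcont (fun x => E x - J x)).
have S2 : (\int[mu]_(x in `]0%R, +oo[%classic) (J x)%:E +
    \int[mu]_(x in `]0%R, +oo[%classic) (E x - J x)%:E = 4%:E)%E.
  rewrite -IE -ge0_integralD//.
  - by apply: eq_integral => x _; rewrite -EFinD addrC subrK.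
  - by move=> x _; rewrite lee_fin.
  - exact: mcont.
  - exact: (mcont (fun x => E x - J x)).
have IPJ : (\int[mu]_(x in `]0%R, +oo[%classic) (P x)%:E =
    \int[mu]_(x in `]0%R, +oo[%classic) (J x)%:E)%E.
  (* The summand common to [S1] and [S2] can be cancelled in the extended reals only once it is
     finite. *)
  have f0 : (\int[mu]_(x in `]0%R, +oo[%classic) (E x - J x)%:E \is a fin_num)%E.
    rewrite ge0_fin_numE; last exact: integral_ge0.
    rewrite (@le_lt_trans _ _ 4%:E) ?ltry// -S1 leeDr// integral_ge0// => x _.
    by rewrite lee_fin.
  by rewrite -[LHS](addeK _ f0) S1 -S2 addeK.
have J0' x : (`]0%R, +oo[%classic : set R) x -> (0 <= (J x)%:E)%E by rewrite lee_fin.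
have fJ : (\int[mu]_(x in `]0%R, +oo[%classic) (J x)%:E < +oo)%E.
  rewrite (@le_lt_trans _ _ 4%:E) ?ltry// -S2 leeDl//.
  exact: integral_ge0.
have GJ : Gamma (b + 1) = \int[mu]_(x in `]0, +oo[%classic) J x.
  by rewrite /Gamma; under eq_Rintegral do rewrite addrK.
split.
  have IP : (\int[mu]_(x in `]0%R, +oo[%classic) (P x)%:E =
      b%:E * \int[mu]_(x in `]0%R, +oo[%classic) (x `^ (b - 1) * expR (- x))%:E)%E.
    under eq_integral do rewrite EFinM.
    rewrite ge0_integralZl//.
    - apply: (mcont (fun x => x `^ (b - 1) * expR (- x))) => x x0.
      exact: continuous_powR_expRN.
    - by move=> x _; rewrite lee_fin mulr_ge0 ?powR_ge0 ?expR_ge0.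
    - by rewrite lee_fin ltW.
  rewrite GJ /Gamma /Rintegral -IPJ IP fineM//.
  rewrite ge0_fin_numE; last first.
    apply: integral_ge0 => x _.
    by rewrite lee_fin mulr_ge0 ?powR_ge0 ?expR_ge0.
  have := fJ; rewrite -IPJ IP; case: (\int[mu]_(x in _) _)%E => [r||]//=.
    by move=> _; rewrite ltry.
  by rewrite gt0_muley ?lte_fin.
rewrite GJ /Rintegral fine_gt0// fJ andbT.
(* Positivity comes from [[1, 2]], where [x^b >= 1] and [e^(-x) >= e^(-2)]. *)
apply: (@lt_le_trans _ _ (\int[mu]_(x in `[1%R, 2%R]%classic) (expR (- 2))%:E)%E).
  rewrite integral_cst//= lebesgue_measure_itv/= lte_fin ltr1n/=.
  by rewrite -EFinD -EFinM lte_fin mulr_gt0 ?expR_gt0// subr_gt0 ltr1n.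
have s12 : ((`[1%R, 2%R] : set R) `<=` `]0%R, +oo[)%classic.
  by move=> x /=; rewrite !in_itv/= andbT => /andP[x1 _]; apply: lt_le_trans x1.
apply: (@le_trans _ _ (\int[mu]_(x in `[1%R, 2%R]%classic) (J x)%:E)%E).
  apply: ge0_le_integral => //.
  - exact: measurable_funS (mcont J cJ).
  - move=> x /=; rewrite in_itv/= => /andP[x1 x2].
    rewrite lee_fin -[leLHS]mul1r ler_pM ?expR_ge0 ?ler_expR ?lerN2//.
    by rewrite -(powRr0 x) ler_powR// ltW.
apply: ge0_subset_integral => //; exact: mcont.
Unshelve. all: by end_near. Qed.

(** * Positivity of a quadratic form by Abel summation *)

(** Summation by parts; [f 0 = 0] makes the differences telescope to [f n], so no boundary term is
    left. *)
Lemma abel_sum (R : pzRingType) (f : nat -> R) (n : nat) (a : nat -> R) : f 0%N = 0 ->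
  \sum_(1 <= i < n) (f i - f i.-1) * (\sum_(i <= j < n) a j) =
  \sum_(1 <= j < n) f j * a j.
Proof.
move=> f0; elim: n => [|[|n] IH]; [by rewrite !big_geq|by rewrite !big_geq|].
rewrite big_nat_recr//= [RHS]big_nat_recr//= big_nat1 -IH.
have -> : \sum_(1 <= i < n.+1) (f i - f i.-1) * \sum_(i <= j < n.+2) a j =
    \sum_(1 <= i < n.+1) (f i - f i.-1) * \sum_(i <= j < n.+1) a j + f n * a n.+1.
  have -> : f n = \sum_(1 <= i < n.+1) (f i - f i.-1).
    by rewrite big_add1 telescope_sumr// f0 subr0.
  rewrite mulr_suml -big_split/=; apply: eq_big_nat => i /andP[_ ip].
  by rewrite big_nat_recr/= ?mulrDr// ltnW.
by rewrite -addrA -mulrDl subrKC.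
Qed.

Section InnerProduct.
Variables (R : realType) (V : lmodType R) (ip : V -> V -> R).
Hypothesis hip : is_inner_product ip.

Lemma ip_sym x y : ip x y = ip y x. Proof. by have [] := hip. Qed.

Lemma ipDl x y z : ip (x + y) z = ip x z + ip y z.
Proof. by have [_ /(_ 1 x y z)] := hip; rewrite scale1r mul1r. Qed.

Lemma ip0l z : ip 0 z = 0.
Proof. by apply: (addrI (ip 0 z)); rewrite -ipDl !addr0. Qed.

Lemma ipZl a x z : ip (a *: x) z = a * ip x z.
Proof. by have [_ /(_ a x 0 z)] := hip; rewrite !addr0 ip0l addr0. Qed.

Lemma ip_ge0 x : 0 <= ip x x. Proof. by have [] := hip. Qed.

Lemma ip_suml (I : Type) (r : seq I) (P : pred I) (F : I -> V) z :
  ip (\sum_(i <- r | P i) F i) z = \sum_(i <- r | P i) ip (F i) z.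
Proof.
exact: (big_morph (ip^~ z) (fun x y => ipDl x y z) (ip0l z)).
Qed.

Lemma ip_sqrD x y : ip (x + y) (x + y) = ip x x + ip y y + 2 * ip x y.
Proof. by rewrite ipDl !(ip_sym _ (x + y)) !ipDl (ip_sym y x); ring. Qed.

(** [S] is read on and below the diagonal only; the factor 2 supplies the symmetric upper half. *)
Definition quad_form (S : nat -> nat -> R) (x : nat -> V) (n : nat) : R :=
  \sum_(1 <= k < n.+1)
     (S k k * ip (x k) (x k) + 2 * \sum_(1 <= j < k) S k j * ip (x j) (x k)).

(* With the column 0 of [S] set to 0, Abel summation along the row [p] of [S]
   and then along columns writes the form as a combination of the squared norms
   of [\sum_(i <= j < p.+1) x j] weighted by mixed second differences of [S];
   the induction keeps only the part supported on the last row. *)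
Lemma quad_form_ge (S : nat -> nat -> R) (x : nat -> V) (n : nat) :
  (forall k, S k 0%N = 0) ->
  (forall i m, (0 < i <= m)%N -> (m < n)%N ->
     S m.+1 i - S m.+1 i.-1 <= S m i - S m i.-1) ->
  forall p, (p <= n)%N ->
  \sum_(1 <= i < p.+1) (S p i - S p i.-1) *
     ip (\sum_(i <= j < p.+1) x j) (\sum_(i <= j < p.+1) x j) <= quad_form S x p.
Proof.
move=> S0 Sw; elim=> [_|p IH pn]; first by rewrite /quad_form !big_geq.
pose y i := \sum_(i <= j < p.+1) x j; set z := x p.+1.
pose D i := S p.+1 i - S p.+1 i.-1.
(* Expand [|y i + z|^2]: the [|z|^2] terms telescope to the diagonal entry, and the cross terms fold
   back by [abel_sum] into row [p.+1] of the form. *)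
have -> : \sum_(1 <= i < p.+2) D i *
      ip (\sum_(i <= j < p.+2) x j) (\sum_(i <= j < p.+2) x j) =
    \sum_(1 <= i < p.+1) D i * ip (y i) (y i) +
      (S p.+1 p.+1 * ip z z + 2 * \sum_(1 <= j < p.+1) S p.+1 j * ip (x j) z).
  rewrite -(abel_sum p.+1 (fun j => ip (x j) z) (S0 p.+1)).
  have -> : S p.+1 p.+1 = \sum_(1 <= i < p.+2) D i.
    by rewrite big_add1 telescope_sumr// S0 subr0.
  rewrite big_nat_recr//= [in X in _ = _ + (X + _)]big_nat_recr//= big_nat1.
  have -> : \sum_(1 <= i < p.+1) D i *
        ip (\sum_(i <= j < p.+2) x j) (\sum_(i <= j < p.+2) x j) =
      \sum_(1 <= i < p.+1) D i * ip (y i) (y i) +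
      (\sum_(1 <= i < p.+1) D i) * ip z z + 2 * \sum_(1 <= i < p.+1)
        (S p.+1 i - S p.+1 i.-1) * \sum_(i <= j < p.+1) ip (x j) z.
    rewrite mulr_suml mulr_sumr -!big_split/=.
    apply: eq_big_nat => i /andP[i0 ilep].
    rewrite big_nat_recr/=; last exact: ltnW.
    rewrite ip_sqrD -ip_suml -/(y i) -/z -/(D i).
    by move: (D i) (ip _ _) (ip _ _) (ip _ _) => a b c d; ring.
  have aux (a b c d e : R) : a + b * e + 2 * c + d * e = a + ((b + d) * e + 2 * c).
    by ring.
  exact: aux.
rewrite [leRHS]/quad_form [leRHS]big_nat_recr//= lerD2r.
apply: le_trans (IH (ltnW pn)); rewrite big_nat [leRHS]big_nat ler_sum// => i i1p.
by rewrite ler_wpM2r ?ip_ge0// Sw// -ltnS.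
Qed.

Lemma quad_form_ge0 (S : nat -> nat -> R) (x : nat -> V) (n : nat) :
  (forall k, S k 0%N = 0) ->
  (forall i m, (0 < i <= m)%N -> (m < n)%N ->
     S m.+1 i - S m.+1 i.-1 <= S m i - S m i.-1) ->
  (forall i, (0 < i <= n)%N -> S n i.-1 <= S n i) ->
  0 <= quad_form S x n.
Proof.
move=> S0 Sw Sn; apply: le_trans (quad_form_ge x S0 Sw (leqnn n)).
rewrite big_nat sumr_ge0// => i /andP[i0 ilen]; rewrite mulr_ge0 ?ip_ge0//.
by rewrite subr_ge0 Sn// i0.
Qed.
End InnerProduct.

(** * Convex nondecreasing kernels on the unit interval *)

Local Notation "\int01 f" := (\int[lebesgue_measure]_(x in `[0%R, 1%R]%classic) f x)
  (at level 36, f at level 36) : ring_scope.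
Definition cont01 (R : realType) (f : R -> R) : Prop :=
  {within `[0%R, 1%R]%classic, continuous f}%classic.

(** * Means, moments and tilted means over the unit interval *)

Section Int01.
Variable R : realType.
Implicit Types f g F : R -> R.

Lemma integrable01 f : cont01 f ->
  (@lebesgue_measure R).-integrable `[0%R, 1%R]%classic (EFin \o f).
Proof. by move=> cf; apply: continuous_compact_integrable => //; exact: segment_compact. Qed.

Lemma cont01D f g : cont01 f -> cont01 g -> cont01 (fun x => f x + g x).
Proof. by move=> cf cg x; apply: cvgD; [exact: cf|exact: cg]. Qed.

Lemma cont01M f g : cont01 f -> cont01 g -> cont01 (fun x => f x * g x).
Proof. by move=> cf cg x; apply: cvgM; [exact: cf|exact: cg]. Qed.

Lemma cont01N f : cont01 f -> cont01 (fun x => - f x).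
Proof. by move=> cf x; apply: cvgN; exact: cf. Qed.

Lemma cont01_cst (c : R) : cont01 (fun=> c).
Proof. by move=> x; exact: cvg_cst. Qed.

Lemma cont01_derive f f' : (forall x : R, 0 <= x <= 1 -> is_derive x 1 f (f' x)) -> cont01 f.
Proof.
move=> df; apply: continuous_in_subspaceT => x; rewrite inE/= in_itv/= => /df[+ _].
by move=> /derivable1_diffP/differentiable_continuous.
Qed.

Lemma cont01Z (c : R) f : cont01 f -> cont01 (fun x => c * f x).
Proof. by move=> cf; apply: cont01M => //; exact: cont01_cst. Qed.

Lemma cont01_id : cont01 (fun x : R => x).
Proof. exact: (@cont01_derive _ (fun=> 1)). Qed.

Lemma int01D f g : cont01 f -> cont01 g ->
  \int01 (fun x => f x + g x) = \int01 f + \int01 g.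
Proof. by move=> cf cg; rewrite RintegralD//; exact: integrable01. Qed.

Lemma int01Z (c : R) f : cont01 f -> \int01 (fun x => c * f x) = c * \int01 f.
Proof. by move=> cf; rewrite RintegralZl//; exact: integrable01. Qed.

Lemma le_int01 f g : cont01 f -> cont01 g ->
  (forall x : R, 0 <= x <= 1 -> f x <= g x) -> \int01 f <= \int01 g.
Proof.
move=> cf cg fg; by apply: le_Rintegral => //; exact: integrable01.
Qed.

Lemma eq_int01 f g : (forall x : R, 0 <= x <= 1 -> f x = g x) -> \int01 f = \int01 g.
Proof. by move=> fg; apply: eq_Rintegral => x; rewrite inE/= in_itv/=; exact: fg. Qed.

Lemma int01_FTC f F : cont01 f ->
  (forall x : R, 0 <= x <= 1 -> is_derive x 1 F (f x)) -> \int01 f = F 1 - F 0.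
Proof.
move=> cf dF.
have cF x : 0 <= x <= 1 -> {for x, continuous F}.
  by move=> /dF[+ _] => /derivable1_diffP/differentiable_continuous.
rewrite /Rintegral (@continuous_FTC2 _ f F)//.
- split.
  + by move=> x; rewrite in_itv/= => /andP[x0 x1]; have [] := dF x _; rewrite ?ltW.
  + by apply: cvg_at_right_filter; apply: cF; rewrite lexx ler01.
  + by apply: cvg_at_left_filter; apply: cF; rewrite lexx ler01.
- move=> x; rewrite in_itv/= => /andP[x0 x1]; rewrite derive1E.
  by have [] := dF x _; rewrite ?ltW.
Qed.

Lemma cont01_quad (a b c : R) : cont01 (fun x => a + b * x + c * (x * x)).
Proof.
apply: (@cont01_derive _ (fun x => b + c * (x + x))) => x _.
by apply: is_derive_eq; rewrite /GRing.scale/=; ring.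
Qed.

Lemma int01_quad (a b c : R) :
  \int01 (fun x => a + b * x + c * (x * x)) = a + b / 2 + c / 3.
Proof.
pose F x : R := a * x + b / 2 * (x * x) + c / 3 * (x * (x * x)).
have dF (x : R) : 0 <= x <= 1 -> is_derive x 1 F (a + b * x + c * (x * x)).
  by move=> _; apply: is_derive_eq; rewrite /GRing.scale/=; field.
by rewrite (int01_FTC (@cont01_quad a b c) dF) /F; ring.
Qed.

Definition mean f := \int01 f.
(** The weight [2x - 1] is that of [ccoef]; it integrates to 0, so constants do not contribute. *)
Definition mom f := \int01 (fun x => (2 * x - 1) * f x).

Lemma cont01_mom f : cont01 f -> cont01 (fun x => (2 * x - 1) * f x).
Proof.
move=> cf; apply: cont01M => //; apply: cont01D; last exact: cont01_cst.
exact/cont01Z/cont01_id.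
Qed.

(** The deviation of [f - g x] from its midpoint value has the sign opposite to [2x - 1], and the
    linear part contributes [g / 6]. *)
Lemma mom_le f (g : R) : cont01 f ->
  (forall x y : R, 0 <= x -> x <= y -> y <= 1 -> f y - g * y <= f x - g * x) ->
  mom f <= g / 6.
Proof.
move=> cf fg; set h := f 2^-1 - g / 2.
have -> : g / 6 = \int01 (fun x => - h + (2 * h - g) * x + (2 * g) * (x * x)).
  by rewrite int01_quad; field.
apply: le_int01 => [||x /andP[x0 x1]]; [exact: cont01_mom|exact: cont01_quad|].
suff : (2 * x - 1) * (f x - g * x - h) <= 0 by nra.
have [xh|xh] := leP x 2^-1.
- have := fg x 2^-1 x0 xh; rewrite -/h => /(_ _).
  rewrite invf_le1 ?ler1n// => /(_ isT) fh.
  by rewrite mulr_le0_ge0//; lra.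
- have := fg 2^-1 x _ (ltW xh) x1; rewrite invr_ge0 ler0n -/h => /(_ isT) fh.
  by rewrite mulr_ge0_le0//; lra.
Qed.

Lemma momN f : cont01 f -> mom (fun x => - f x) = - mom f.
Proof.
move=> cf; rewrite -mulN1r -int01Z; last exact: cont01_mom.
by apply: eq_int01 => x _; ring.
Qed.

Lemma mom_ge f (g : R) : cont01 f ->
  (forall x y : R, 0 <= x -> x <= y -> y <= 1 -> f x - g * x <= f y - g * y) ->
  g / 6 <= mom f.
Proof.
move=> cf fg; rewrite -[leRHS]opprK -momN// lerNr -mulNr.
apply: mom_le => [|x y x0 xy y1]; first exact: cont01N.
by have := fg x y x0 xy y1; lra.
Qed.

Lemma mean_le f (g : R) : cont01 f ->
  (forall x y : R, 0 <= x -> x <= y -> y <= 1 -> f x - g * x <= f y - g * y) ->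
  mean f <= f 1 - g / 2.
Proof.
move=> cf fg; have -> : f 1 - g / 2 = \int01 (fun x => (f 1 - g) + g * x + 0 * (x * x)).
  by rewrite int01_quad; field.
apply: le_int01 => // [|x /andP[x0 x1]]; first exact: cont01_quad.
by have := fg x 1 x0 x1 (lexx _); lra.
Qed.

Lemma mean_lin (c : R) f g : cont01 f -> cont01 g ->
  mean (fun x => f x - c * g x) = mean f - c * mean g.
Proof.
move=> cf cg; rewrite /mean int01D//; last by apply: cont01N; exact: cont01Z.
congr (_ + _); rewrite -mulNr -int01Z//; apply: eq_int01 => x _; ring.
Qed.

Lemma mom_lin (c : R) f g : cont01 f -> cont01 g ->
  mom (fun x => f x - c * g x) = mom f - c * mom g.
Proof.
move=> cf cg; rewrite -[RHS]mean_lin; [|exact: cont01_mom|exact: cont01_mom].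
by apply: eq_int01 => x _; ring.
Qed.

(** With [k = 1/(1 + rho_{j+1})] this is the integral in [- acoef]. Its weight [1 - k (2x - 1)] has
    total mass 1 and is nonnegative for [0 <= k <= 1]. *)
Definition tilt (k : R) f := mean f - k * mom f.

Lemma tiltE k f : cont01 f -> tilt k f = \int01 (fun x => (1 - k * (2 * x - 1)) * f x).
Proof.
move=> cf; rewrite /tilt -mulNr -int01Z; last exact: cont01_mom.
rewrite -int01D//; last exact/cont01Z/cont01_mom.
by apply: eq_int01 => x _; ring.
Qed.

Lemma cont01_tilt k f : cont01 f -> cont01 (fun x => (1 - k * (2 * x - 1)) * f x).
Proof.
move=> cf; apply: cont01M => //; apply: (@cont01_derive _ (fun=> - 2 * k)) => x _.
by apply: is_derive_eq; rewrite /GRing.scale/=; ring.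
Qed.

Lemma tilt_cst k (c : R) : tilt k (fun=> c) = c.
Proof.
rewrite tiltE; last exact: cont01_cst.
rewrite (@eq_int01 _ (fun x => (1 + k) * c + (- 2 * k * c) * x + 0 * (x * x))).
  by rewrite int01_quad; field.
by move=> x _; ring.
Qed.

Lemma tiltB_cst k f (c : R) : cont01 f -> tilt k (fun x => f x - c) = tilt k f - c.
Proof.
move=> cf; have -> : (fun x => f x - c) = (fun x => f x - 1 * (fun=> c) x).
  by apply/funext => x; rewrite mul1r.
have := tilt_cst k c; rewrite /tilt => h; rewrite -[in RHS]h.
rewrite mean_lin ?mom_lin//; first (by move: (mean _) (mean _) (mom _) (mom _) => *; ring).
all: exact: cont01_cst.
Qed.

Lemma le_tilt k f g : 0 <= k <= 1 -> cont01 f -> cont01 g ->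
  (forall x : R, 0 <= x <= 1 -> f x <= g x) -> tilt k f <= tilt k g.
Proof.
move=> /andP[k0 k1] cf cg fg; rewrite !tiltE//.
apply: le_int01 => [||x x01]; [exact: cont01_tilt|exact: cont01_tilt|].
by apply: ler_wpM2l (fg _ x01); case/andP: x01 => x0 x1; nra.
Qed.

End Int01.

(** * Supporting lines and differences of negative powers *)

Section ConvexIncreasing.
Variable R : realType.
Implicit Types (w : R -> R) (B : R).

Lemma ler_derive (f f' : R -> R) (x y : R) : x <= y ->
  (forall z, x <= z <= y -> is_derive z 1 f (f' z)) ->
  (forall z, x <= z <= y -> 0 <= f' z) -> f x <= f y.
Proof.
move=> xy df f'0; apply: (@ger0_derive1_le_cc R f x y) => //.
- by move=> z; rewrite in_itv/= => /andP[xz zy]; have [] := df z _; rewrite ?ltW.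
- move=> z; rewrite in_itv/= => /andP[xz zy].
  have zi : x <= z <= y by rewrite !ltW.
  by have [_ fz] := df z zi; rewrite derive1E fz f'0.
- apply: continuous_in_subspaceT => z; rewrite inE/= in_itv/= => /df[+ _].
  by move=> /derivable1_diffP/differentiable_continuous.
- by rewrite in_itv/= lexx.
- by rewrite in_itv/= lexx andbT.
Qed.

(* Convexity and monotonicity on ]-oo, B], phrased by supporting lines because
   this is the only form in which they are used. *)
Definition cvx_ndecr B w : Prop :=
  (forall s, s <= B -> {for s, continuous w}) /\
  (forall s, s <= B -> exists2 g : R, 0 <= g &
    (forall x y, x <= y -> y <= s -> w y - g * y <= w x - g * x) /\
    (forall x y, s <= x -> x <= y -> y <= B -> w x - g * x <= w y - g * y)).

Lemma cvx_ndecr_le B w x y : cvx_ndecr B w -> x <= y -> y <= B -> w x <= w y.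
Proof.
move=> [_ /(_ x) + ] xy yB; move=> /(_ (le_trans xy yB))[g g0 [_ /(_ x y)]].
move=> /(_ (lexx _) xy yB); have : g * x <= g * y by rewrite ler_wpM2l.
lra.
Qed.

Definition pw (p be s : R) : R := (p - s) `^ (- be).

Lemma is_derive_pw (p be s : R) : s < p -> is_derive s 1 (pw p be) (be * pw p (be + 1) s).
Proof.
move=> sp; have ps : 0 < p - s by rewrite subr_gt0.
have d1 : is_derive (p - s) 1 ((@powR R)^~ (- be)) (- be * (p - s) `^ (- be - 1)).
  exact: is_derive1_powR.
have d2 : is_derive s 1 (fun y : R => p - y) (- 1).
  by apply: is_derive_eq; rewrite /GRing.scale/=; ring.
have d := @is_derive1_comp R (fun y => y `^ (- be)) (fun y => p - y) s _ _ d1 d2.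
have -> : pw p be = (fun y => y `^ (- be)) \o (fun y => p - y) by [].
by apply: (is_derive_eq d); rewrite /pw opprD; ring.
Qed.

Lemma pw_diff_ge0 (p q c be s : R) : 0 <= be -> 0 <= c <= 1 -> s < p -> p <= q ->
  0 <= pw p be s - c * pw q be s.
Proof.
move=> be0 /andP[c0 c1] sp pq; rewrite subr_ge0.
have : pw q be s <= pw p be s.
  rewrite /pw !powRN lef_pV2 ?posrE ?powR_gt0 ?subr_gt0//; last exact: lt_le_trans pq.
  by rewrite ge0_ler_powR// ?nnegrE ?subr_ge0 ?lerB// ltW// (lt_le_trans sp).
have : 0 <= pw q be s by exact: powR_ge0.
nra.
Qed.

(** The derivative of such a difference is [be] times the difference with exponent [be + 1], again
    nonnegative. Applied twice, this makes both the function and its slope nondecreasing, and the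
    slope at [s] serves as [g]. The values [c = 0] and [c = 1] give one kernel and the difference of
    two. *)
Lemma pw_diff_cvx (p q c be B : R) : 0 <= be -> 0 <= c <= 1 -> B < p -> p <= q ->
  cvx_ndecr B (fun s => pw p be s - c * pw q be s).
Proof.
move=> be0 c01 Bp pq.
pose G (be s : R) := pw p be s - c * pw q be s.
have G0 (b s : R) : 0 <= b -> s <= B -> 0 <= G b s.
  by move=> b0 sB; rewrite pw_diff_ge0// (le_lt_trans sB).
have dG (b s : R) : s <= B -> is_derive s 1 (G b) (b * G (b + 1) s).
  move=> sB; have sp := le_lt_trans sB Bp; have sq := lt_le_trans sp pq.
  have d1 := is_derive_pw b sp; have d2 := is_derive_pw b sq.
  apply: is_derive_eq; rewrite /GRing.scale/= /G; ring.
have Gle (b x y : R) : 0 <= b -> x <= y -> y <= B -> G b x <= G b y.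
  move=> b0 xy yB; apply: (@ler_derive _ (fun s => b * G (b + 1) s)) => // z /andP[_ zy].
    by apply: dG; exact: le_trans yB.
  by rewrite mulr_ge0// G0 ?addr_ge0// (le_trans zy).
have b10 : 0 <= be + 1 by rewrite addr_ge0.
split=> [s sB|s sB].
  have [+ _] := dG be s sB.
  by move=> /derivable1_diffP/differentiable_continuous.
exists (be * G (be + 1) s); first by rewrite mulr_ge0// G0.
have dH (z : R) : z <= B -> is_derive z 1 (fun x => G be x - be * G (be + 1) s * x)
    (be * G (be + 1) z - be * G (be + 1) s).
  by move=> zB; have dGz := dG be z zB; apply: is_derive_eq; rewrite /GRing.scale/=; ring.
split=> x y.
- move=> xy ys; rewrite -lerN2.
  apply: (@ler_derive (fun x => - (G be x - be * G (be + 1) s * x))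
    (fun z => - (be * G (be + 1) z - be * G (be + 1) s))) => // z /andP[_ zy].
    have zB : z <= B := le_trans (le_trans zy ys) sB.
    by have dHz := dH z zB; apply: is_derive_eq.
  by rewrite oppr_ge0 subr_le0 ler_wpM2l// Gle// (le_trans zy).
- move=> sx xy yB.
  apply: (@ler_derive (fun x => (G be x - be * G (be + 1) s * x))
    (fun z => (be * G (be + 1) z - be * G (be + 1) s))) => // z /andP[xz zy].
    exact: dH (le_trans zy yB).
  by rewrite subr_ge0 ler_wpM2l// Gle ?(le_trans sx)// (le_trans zy).
Qed.

End ConvexIncreasing.

(** * Kernels pulled back to the mesh *)

Section Mesh.
Variables (R : realType) (t : nat -> R).
Hypothesis ht : forall j, t j < t j.+1.
Hypothesis hratio : forall l, (0 < l)%N ->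
  (rho t l.+1 ^+ 2 * (1 + rho t l.+1))^-1 <= 3 + (rho t l.+2)^-1.
Implicit Types (w : R -> R) (B : R).

Definition pull w j (x : R) : R := w (t j.-1 + x * tau t j).

Lemma tau_gt0 j : (0 < j)%N -> 0 < tau t j.
Proof. by case: j => // j _; rewrite /tau/= subr_gt0. Qed.

Lemma rho_gt0 j : (1 < j)%N -> 0 < rho t j.
Proof. by case: j => [|[|j]]// _; rewrite /rho divr_gt0// tau_gt0. Qed.

Lemma mesh_le i j : (i <= j)%N -> t i <= t j.
Proof.
elim: j => [|j IH]; first by case: i.
rewrite leq_eqVlt => /predU1P[->//|/IH ij]; exact: le_trans ij (ltW (ht j)).
Qed.

Lemma pull_arg_le j (x : R) : 0 <= x <= 1 -> t j.-1 + x * tau t j <= t j.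
Proof.
move=> /andP[x0 x1]; have : t j.-1 <= t j by rewrite mesh_le ?leq_pred.
rewrite /tau; nra.
Qed.

Lemma pull_arg_homo j (x y : R) : x <= y -> t j.-1 + x * tau t j <= t j.-1 + y * tau t j.
Proof. by move=> xy; rewrite lerD2l ler_wpM2r// /tau subr_ge0 mesh_le ?leq_pred. Qed.

Lemma pull0 w j : pull w j 0 = w (t j.-1).
Proof. by rewrite /pull mul0r addr0. Qed.

Lemma pull1 w j : pull w j 1 = w (t j).
Proof. by rewrite /pull mul1r /tau addrC subrK. Qed.

Lemma cont_pull B w j : cvx_ndecr B w -> t j <= B -> cont01 (pull w j).
Proof.
move=> [cw _] jB; apply: continuous_in_subspaceT => x; rewrite inE/= in_itv/= => x01.
apply: continuous_comp; last by apply: cw; exact: le_trans (pull_arg_le j x01) jB.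
apply: cvgD; first exact: cvg_cst.
by apply: cvgM; [exact: cvg_id|exact: cvg_cst].
Qed.

(** [rise] and [jump] split the increment [dcoef i - dcoef i.-1]: [rise] is what subinterval [i]
    contributes beyond the value at its left node, [jump] is that node value together with the
    earlier subintervals. *)
Definition rise w i : R := tilt (1 + rho t i.+1)^-1 (pull w i) - w (t i.-1).

(* There is no subinterval 0: its moment is dropped from [jump w 2], and
   [jump w 1] is chosen so that [dcoef_diff] also holds for the first column. *)
Definition jump w i : R :=
  if i is l.+2 then
    mom (pull w l.+1) / rho t l.+2 + (w (t l.+1) - mean (pull w l.+1)) -
    (if (0 < l)%N then mom (pull w l) / (rho t l.+1 * (1 + rho t l.+1)) else 0)
  else w (t 0%N).

Lemma kappa01 i : (0 < i)%N -> 0 <= (1 + rho t i.+1)^-1 <= 1.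
Proof.
move=> i0; have r0 := @rho_gt0 i.+1 i0.
by rewrite invr_ge0 invf_le1 ?addr_gt0// lerDl addr_ge0 ltW.
Qed.

Lemma rise_ge0 B w i : cvx_ndecr B w -> (0 < i)%N -> t i <= B -> 0 <= rise w i.
Proof.
move=> cw i0 iB; rewrite subr_ge0 -(tilt_cst (1 + rho t i.+1)^-1 (w (t i.-1))).
apply: le_tilt (kappa01 i0) _ _ _ => [||x x01].
- exact: cont01_cst.
- exact: cont_pull cw iB.
- rewrite -pull0; apply: (cvx_ndecr_le cw); last exact: le_trans (pull_arg_le i x01) iB.
  by apply: pull_arg_homo; case/andP: x01.
Qed.

Lemma tilt_pull_le B w i : cvx_ndecr B w -> (0 < i)%N -> t i <= B ->
  tilt (1 + rho t i.+1)^-1 (pull w i) <= w (t i).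
Proof.
move=> cw i0 iB; rewrite -[leRHS](tilt_cst (1 + rho t i.+1)^-1).
apply: le_tilt (kappa01 i0) _ _ _ => [||x x01].
- exact: cont_pull cw iB.
- exact: cont01_cst.
- by apply: (cvx_ndecr_le cw) => //; exact: pull_arg_le.
Qed.

(** For [i = l.+2] take the supporting line at [t l], the node common to subintervals [l] and
    [l.+1], with slope [g]. On the right it bounds the moment below by [g tau / 6] and the end value
    minus the mean by [g tau / 2]; on the left it bounds the subtracted moment above by [g tau / 6].
    The inequality left over is [hratio]. *)
Lemma jump_ge0 B w i : cvx_ndecr B w -> (forall s, s <= B -> 0 <= w s) ->
  t i.-1 <= B -> 0 <= jump w i.
Proof.
case: i => [|[|l]]//= cw w0 lB; rewrite ?w0//.
have llB : t l <= B by rewrite (le_trans _ lB)// mesh_le.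
have cR := cont_pull cw lB.
have [g g0 [gl gr]] := cw.2 (t l) llB.
have t0 : 0 < tau t l.+1 by rewrite tau_gt0.
have q0 : 0 < rho t l.+2 by rewrite rho_gt0.
have pr (x y : R) : 0 <= x -> x <= y -> y <= 1 ->
    pull w l.+1 x - g * tau t l.+1 * x <= pull w l.+1 y - g * tau t l.+1 * y.
  move=> x0 xy y1; have := gr (t l + x * tau t l.+1) (t l + y * tau t l.+1).
  have y01 : 0 <= y <= 1 by rewrite (le_trans x0).
  rewrite lerDl mulr_ge0 ?(ltW t0)// => /(_ isT (@pull_arg_homo l.+1 x y xy)).
  move=> /(_ (le_trans (@pull_arg_le l.+1 y y01) lB)); rewrite /pull/=.
  by rewrite !mulrDr; lra.
have m1 := mom_ge cR pr; have m2 := mean_le cR pr; rewrite pull1 in m2.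
have m3 : g * tau t l.+1 / 6 / rho t l.+2 <= mom (pull w l.+1) / rho t l.+2.
  by rewrite ler_wpM2r// invr_ge0 ltW.
have gt0' : 0 <= g * tau t l.+1 / 6 / rho t l.+2.
  by rewrite !mulr_ge0// ?invr_ge0 ltW.
have gt1 : 0 <= g * tau t l.+1 by rewrite mulr_ge0// ltW.
case: ifPn => l0; last by lra.
have cL := cont_pull cw llB.
have tl0 : 0 < tau t l by rewrite tau_gt0.
have r0 : 0 < rho t l.+1 by rewrite rho_gt0.
have pl (x y : R) : 0 <= x -> x <= y -> y <= 1 ->
    pull w l y - g * tau t l * y <= pull w l x - g * tau t l * x.
  move=> x0 xy y1; have := gl (t l.-1 + x * tau t l) (t l.-1 + y * tau t l).
  have y01 : 0 <= y <= 1 by rewrite (le_trans x0).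
  move=> /(_ (@pull_arg_homo l x y xy) (@pull_arg_le l y y01)); rewrite /pull/=.
  by rewrite !mulrDr; lra.
have m4 := mom_le cL pl.
have m5 : mom (pull w l) / (rho t l.+1 * (1 + rho t l.+1)) <=
    g * tau t l / 6 / (rho t l.+1 * (1 + rho t l.+1)).
  by rewrite ler_wpM2r// invr_ge0 mulr_ge0// ltW// addr_gt0.
(* Everything becomes a multiple of [g tau_{l+1} / 6]; the 3 in [hratio] is the ratio of [1/2] to
   [1/6]. *)
have e1 : g * tau t l / 6 / (rho t l.+1 * (1 + rho t l.+1)) =
    g * tau t l.+1 / 6 * (rho t l.+1 ^+ 2 * (1 + rho t l.+1))^-1.
  have -> : tau t l.+1 = rho t l.+1 * tau t l by rewrite /rho divfK// gt_eqF.
  by field; rewrite !gt_eqF// addr_gt0.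
have : g * tau t l.+1 / 6 * (rho t l.+1 ^+ 2 * (1 + rho t l.+1))^-1 <=
    g * tau t l.+1 / 6 * (3 + (rho t l.+2)^-1).
  by rewrite ler_wpM2l ?hratio// mulr_ge0.
rewrite [X in _ <= X -> _]mulrDr -e1; lra.
Qed.

Lemma rise_lin B (c : R) w w' i : cvx_ndecr B w -> cvx_ndecr B w' -> t i <= B ->
  rise (fun s => w s - c * w' s) i = rise w i - c * rise w' i.
Proof.
move=> cw cw' iB; have ci := cont_pull cw iB; have ci' := cont_pull cw' iB.
rewrite /rise /tilt -[pull (fun s => _) i]/(fun x => pull w i x - c * pull w' i x).
by rewrite mean_lin// mom_lin//; ring.
Qed.

Lemma jump_lin B (c : R) w w' i : cvx_ndecr B w -> cvx_ndecr B w' -> t i.-1 <= B ->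
  jump (fun s => w s - c * w' s) i = jump w i - c * jump w' i.
Proof.
case: i => [|[|l]]//= cw cw' iB.
have lB : t l <= B by rewrite (le_trans _ iB)// mesh_le.
have ci := cont_pull cw iB; have ci' := cont_pull cw' iB.
have cl := cont_pull cw lB; have cl' := cont_pull cw' lB.
rewrite -[pull (fun s => _) l.+1]/(fun x => pull w l.+1 x - c * pull w' l.+1 x).
rewrite -[pull (fun s => _) l]/(fun x => pull w l x - c * pull w' l x).
by rewrite mean_lin// !mom_lin//; case: ifP => _; ring.
Qed.

End Mesh.

(** * The coefficients of the scheme *)

Section Coefficients.
Variables (R : realType) (t : nat -> R) (alpha : R).
Hypothesis ht : forall j, t j < t j.+1.
Hypothesis halpha : 0 < alpha < 1.
Local Notation sg := (sig alpha).

Let a0 : 0 < alpha. Proof. by case/andP: halpha. Qed.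
Let a1 : alpha < 1. Proof. by case/andP: halpha. Qed.

Lemma sig_ge12 : 2^-1 < sg.
Proof. by rewrite /sig; have := a1; lra. Qed.

Lemma sig_gt0 : 0 < sg.
Proof. by have := sig_ge12; lra. Qed.

Definition kern m : R -> R := pw (tstar alpha t m) alpha.

Lemma kernE m : (0 < m)%N -> kern m (t m.-1) = ((sg * tau t m) `^ alpha)^-1.
Proof. by move=> m0; rewrite /kern /pw powRN /tstar [X in (X `^ _)^-1]addrAC subrr add0r. Qed.

Lemma tstar_gt m : (0 < m)%N -> t m.-1 < tstar alpha t m.
Proof. by move=> m0; rewrite /tstar ltrDl mulr_gt0 ?sig_gt0 ?tau_gt0. Qed.

(** As [0 < sigma < 1], the node [t m] separates the two points. *)
Lemma tstar_le m : (0 < m)%N -> tstar alpha t m <= tstar alpha t m.+1.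
Proof.
move=> m0; have t1 : 0 < tau t m by rewrite tau_gt0.
have : 0 < sg * tau t m.+1 by rewrite mulr_gt0 ?sig_gt0 ?tau_gt0.
have : sg * tau t m <= tau t m by rewrite ler_piMl ?(ltW t1)// /sig; have := a0; lra.
by rewrite /tstar/= /tau; lra.
Qed.

Lemma kern_diff_cvx (c : R) m : 0 <= c <= 1 -> (0 < m)%N ->
  cvx_ndecr (t m.-1) (fun s => kern m s - c * kern m.+1 s).
Proof.
move=> c01 m0; apply: pw_diff_cvx => //; [exact/ltW/a0|exact: tstar_gt|exact: tstar_le].
Qed.

Lemma kern_diff_ge0 (c : R) m s : 0 <= c <= 1 -> (0 < m)%N -> s <= t m.-1 ->
  0 <= kern m s - c * kern m.+1 s.
Proof.
move=> c01 m0 sm; apply: pw_diff_ge0 => //; [exact/ltW/a0| |exact: tstar_le].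
exact: le_lt_trans sm (tstar_gt m0).
Qed.

Lemma kern_cvx m : (0 < m)%N -> cvx_ndecr (t m.-1) (kern m).
Proof.
move=> m0; have := @kern_diff_cvx 0 m; rewrite lexx ler01 => /(_ isT m0).
by congr cvx_ndecr; apply/funext => s; rewrite mul0r subr0.
Qed.

Lemma kern_ge0 m s : 0 <= kern m s. Proof. exact: powR_ge0. Qed.

Lemma kern_cvx_le m i : (0 < m)%N -> (i < m)%N -> cvx_ndecr (t i) (kern m).
Proof.
move=> m0 im; have iB : t i <= t m.-1 by rewrite mesh_le// -ltnS prednK.
have [cw sw] := kern_cvx m0; split=> [s si|s si]; first exact/cw/(le_trans si).
have [g g0 [gl gr]] := sw s (le_trans si iB); exists g => //; split=> // x y sx xy yi.
exact: gr (le_trans yi iB).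
Qed.

Lemma cont_pull_kern m j : (0 < j < m)%N -> cont01 (pull t (kern m) j).
Proof.
move=> /andP[j0 jm]; apply: (cont_pull ht (kern_cvx_le _ jm)) => //.
exact: leq_ltn_trans jm.
Qed.

Lemma pull_kernE m j x : pull t (kern m) j x =
  ((tstar alpha t m - t j.-1 - x * tau t j) `^ alpha)^-1.
Proof. by rewrite /pull /kern /pw powRN opprD addrA. Qed.

(** The weight [(2 tau_j (1 - x) + tau_{j+1}) / (tau_j + tau_{j+1})] equals
    [1 - (2x - 1) / (1 + rho_{j+1})]. *)
Lemma acoefE m j : (0 < j < m)%N ->
  acoef alpha t m j = - tilt (1 + rho t j.+1)^-1 (pull t (kern m) j).
Proof.
move=> jm; have cp := cont_pull_kern jm; rewrite /acoef jm tiltE// -[RHS]mulN1r.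
rewrite -int01Z; last exact: cont01_tilt.
case/andP: jm => j0 _; apply: eq_int01 => x _.
have t0 := tau_gt0 ht j0; have t1 := @tau_gt0 _ _ ht j.+1 isT.
rewrite pull_kernE /rho/=; move: (_ `^ _) => P; rewrite invfM; move: (P^-1) => Q.
by field; rewrite !gt_eqF// addr_gt0.
Qed.

Lemma ccoefE m j : (0 < j < m)%N ->
  ccoef alpha t m j = mom (pull t (kern m) j) / (rho t j.+1 * (1 + rho t j.+1)).
Proof.
move=> jm; have cp := cont_pull_kern jm; rewrite /ccoef jm [RHS]mulrC.
rewrite -int01Z; last exact: cont01_mom.
case/andP: jm => j0 _; apply: eq_int01 => x _.
have t0 := tau_gt0 ht j0; have t1 := @tau_gt0 _ _ ht j.+1 isT.
rewrite pull_kernE /rho/=; move: (_ `^ _) => P; rewrite invfM; move: (P^-1) => Q.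
by field; rewrite !gt_eqF// addr_gt0.
Qed.

Lemma ccoef0 m : ccoef alpha t m 0 = 0. Proof. by []. Qed.

Lemma ccoef_ge0 m j : 0 <= ccoef alpha t m j.
Proof.
have [jm|jm] := boolP (0 < j < m)%N; last by rewrite /ccoef (negbTE jm).
have cp := cont_pull_kern jm; rewrite ccoefE//; case/andP: jm => j0 jm.
have r0 : 0 < rho t j.+1 by rewrite rho_gt0.
apply: divr_ge0; last by apply: mulr_ge0; lra.
rewrite -(mul0r 6^-1); apply: mom_ge => // x y x0 xy y1; rewrite !mul0r !subr0.
apply: (cvx_ndecr_le (kern_cvx_le (leq_ltn_trans (leq0n _) jm) jm)).
  exact: pull_arg_homo.
by apply: pull_arg_le; rewrite // (le_trans x0).
Qed.

Lemma rho_neq0 l : rho t l.+2 != 0.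
Proof. by rewrite gt_eqF// rho_gt0. Qed.

Lemma rho1_neq0 l : 1 + rho t l.+2 != 0.
Proof. by have := @rho_gt0 _ _ ht l.+2 isT; move: (rho _ _) => r r0; rewrite gt_eqF// addr_gt0. Qed.

Lemma dcoef0 m : dcoef alpha t m 0 = 0.
Proof. by rewrite /dcoef /ccoef /acoef/= subr0. Qed.

(** For [i >= 2] the moments over subinterval [i.-1] coming from [ccoef] and [acoef] merge, by
    [1/(rho (1 + rho)) + 1/(1 + rho) = 1/rho]. *)
Lemma dcoef_diff m i : (0 < i < m)%N ->
  dcoef alpha t m i - dcoef alpha t m i.-1 = rise t (kern m) i + jump t (kern m) i.
Proof.
move=> im; case: i im => [|[|l]]// lm.
  by rewrite dcoef0 /dcoef/= ccoef0 acoefE// /rise/=; ring.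
have lm1 : (0 < l.+1 < m)%N by case/andP: lm => _ /ltnW.
rewrite /dcoef/= !acoefE// (ccoefE lm1) /rise/= /tilt.
have -> : ccoef alpha t m l = if (0 < l)%N then
    mom (pull t (kern m) l) / (rho t l.+1 * (1 + rho t l.+1)) else 0.
  case: ifPn => l0; first by rewrite ccoefE// l0 ltnW//; case/andP: lm1.
  by rewrite /ccoef (negbTE l0).
have r2 := rho_neq0 l; have r2' := rho1_neq0 l; have r3' := rho1_neq0 l.+1.
move: (if _ then _ else _) (mom _) (mom _) (mean _) (mean _) => *; field.
by rewrite r2 r2' r3'.
Qed.

(** On the diagonal there is no integral over subinterval [m]: the node value stands where the
    tilted mean would, so [rise] disappears and [jump] remains. *)
Lemma dcoef_last m : (1 < m)%N ->
  ccoef alpha t m m.-1 + kern m (t m.-1) - dcoef alpha t m m.-1 = jump t (kern m) m.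
Proof.
case: m => [|[|l]]// _.
rewrite /dcoef -[l.+2.-1]/l.+1 -[l.+1.-1]/l.
rewrite acoefE ?ltnSn// (@ccoefE l.+2 l.+1) ?ltnSn// /tilt.
have -> : ccoef alpha t l.+2 l = if (0 < l)%N then
    mom (pull t (kern l.+2) l) / (rho t l.+1 * (1 + rho t l.+1)) else 0.
  by case: ifPn => l0; [rewrite ccoefE// l0 ltnW|rewrite /ccoef (negbTE l0)].
have r2 := rho_neq0 l; have r2' := rho1_neq0 l.
rewrite /jump; move: (if _ then _ else _) (mom _) (mean _) => *; field.
by rewrite r2 r2'.
Qed.

(** * The integral term of [gcoef] and its comparison with [rise] *)

Definition dint (r : R) : R := \int01 (fun s => s * (r + s) / (sg * r + s)).

Lemma cont01_dint (r : R) (g : R -> R) : 0 < r -> continuous g ->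
  (forall s : R, 0 <= s <= 1 -> 0 <= g s) ->
  cont01 (fun s => g s * (r + g s) / (sg * r + g s)).
Proof.
move=> r0 cg g0; apply: continuous_in_subspaceT => s; rewrite inE/= in_itv/= => s01.
have sr : sg * r + g s != 0 by rewrite gt_eqF// ltr_wpDr ?g0// mulr_gt0// sig_gt0.
apply: cvgM; last first.
  by apply: cvgV => //; apply: cvgD; [exact: cvg_cst|exact: cg].
by apply: cvgM; [exact: cg|apply: cvgD; [exact: cvg_cst|exact: cg]].
Qed.

Lemma cont01_dint_id (r : R) : 0 < r -> cont01 (fun s => s * (r + s) / (sg * r + s)).
Proof.
by move=> r0; apply: (@cont01_dint r id) => // [x|s /andP[]//]; exact: cvg_id.
Qed.

(** The integrand is at most [2 s], since [sigma > 1/2] gives [r + s <= 2 (sigma r + s)]. *)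
Lemma dint_le1 (r : R) : 0 < r -> dint r <= 1.
Proof.
move=> r0; have -> : 1 = \int01 (fun s : R => 0 + 2 * s + 0 * (s * s)).
  by rewrite int01_quad; field.
apply: le_int01 => [||s /andP[s0 s1]]; [exact: cont01_dint_id|exact: cont01_quad|].
have p := sig_ge12; have sr : 0 < sg * r by rewrite mulr_gt0// sig_gt0.
rewrite ler_pdivrMr; last by lra.
by rewrite add0r mul0r addr0 -mulrA [2 * _]mulrCA ler_wpM2l//; nra.
Qed.

Lemma cont01_pw (p a b be : R) : 0 <= b -> b < p - a ->
  cont01 (fun x => pw p be (a + x * b)).
Proof.
move=> b0 bp.
apply: (@cont01_derive _ _ (fun x => (be * pw p (be + 1) (a + x * b)) * b)) => x /andP[x0 x1].
have xp : a + x * b < p by have : x * b <= b by [rewrite ler_piMl|]; lra.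
have d1 := is_derive_pw be xp.
have d2 : is_derive x 1 (fun x => a + x * b) b.
  by apply: is_derive_eq; rewrite /GRing.scale/=; ring.
exact: (@is_derive1_comp R (pw p be) (fun x => a + x * b) x _ _ d1 d2).
Qed.

(** The exponent [-(alpha + 1)] is split: the part [-alpha] is bounded through
    [sigma r + s >= sigma r], the part [-1] is kept as the denominator of [dint]. *)
Lemma weight_kern_le (r T s : R) : 0 < r -> 0 < T -> 0 <= s ->
  (1 + r)^-1 * s * (r + s) * (alpha * (T * (sg * r + s)) `^ (- (alpha + 1)) * T) <=
  ((sg * T) `^ alpha)^-1 * (alpha / ((1 + r) * r `^ alpha)) *
    (s * (r + s) / (sg * r + s)).
Proof.
move=> r0 T0 s_ge0; have s0 := sig_gt0; set k := (1 + r)^-1.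
have sr0 : 0 < sg * r by rewrite mulr_gt0.
have D0 : 0 < sg * r + s by rewrite ltr_wpDr.
have y0 : 0 < T * (sg * r + s) by rewrite mulr_gt0.
have -> : (T * (sg * r + s)) `^ (- (alpha + 1)) =
    ((T * (sg * r + s)) `^ alpha)^-1 / (T * (sg * r + s)).
  rewrite powRN powRD ?powRr1 ?invfM ?(ltW y0)//.
  by rewrite (gt_eqF y0) implybT.
have le1 : ((T * (sg * r + s)) `^ alpha)^-1 <= ((sg * T) `^ alpha)^-1 / r `^ alpha.
  rewrite -invfM -powRM ?(ltW r0)//; last by rewrite mulr_ge0// ltW.
  rewrite lef_pV2 ?posrE ?powR_gt0 ?mulr_gt0//.
  rewrite ge0_ler_powR ?(ltW a0)// ?nnegrE ?mulr_ge0 ?(ltW s0) ?(ltW T0) ?(ltW r0) ?(ltW D0)//.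
  have -> : sg * T * r = T * (sg * r) by ring.
  by rewrite ler_pM2l// lerDl.
have -> : k * s * (r + s) * (alpha * (((T * (sg * r + s)) `^ alpha)^-1 / (T * (sg * r + s))) * T)
   = k * alpha * (s * (r + s) / (sg * r + s)) * ((T * (sg * r + s)) `^ alpha)^-1.
  move: ((T * (sg * r + s)) `^ alpha)^-1 => Q; move: (sg * r + s) D0 => D D0; clearbody k; field.
  by rewrite !gt_eqF.
have -> : ((sg * T) `^ alpha)^-1 * (alpha / ((1 + r) * r `^ alpha)) *
      (s * (r + s) / (sg * r + s)) =
    k * alpha * (s * (r + s) / (sg * r + s)) * (((sg * T) `^ alpha)^-1 / r `^ alpha).
  rewrite [((1 + r) * _)^-1]invfM -/k; ring.
rewrite ler_wpM2l// mulr_ge0//.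
  by rewrite mulr_ge0 ?(ltW a0)// invr_ge0 addr_ge0// ltW.
by rewrite divr_ge0 ?(ltW D0)// mulr_ge0// addr_ge0// ltW.
Qed.

(* Integration by parts moves the derivative onto the kernel, against the
   primitive [(1 - x) (1 + r - x) / (1 + r)] of the weight that vanishes at 1. *)
Lemma rise_kern_le m : (0 < m)%N ->
  rise t (kern m.+1) m <= ((sg * tau t m) `^ alpha)^-1 *
    (alpha / ((1 + rho t m.+1) * rho t m.+1 `^ alpha) * dint (rho t m.+1)).
Proof.
move=> m0; set r := rho t m.+1; set T := tau t m; set k := (1 + r)^-1.
have T0 : 0 < T by rewrite tau_gt0.
have r0 : 0 < r by rewrite rho_gt0.
have s0 := sig_gt0; have sr0 : 0 < sg * r by rewrite mulr_gt0.
pose p := tstar alpha t m.+1.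
(* The distance to [t*_{m+1}] is measured from the right end of subinterval [m], hence [1 - x]. *)
have pE x : p - (t m.-1 + x * T) = T * (sg * r + (1 - x)).
  have : tau t m.+1 = r * T by rewrite /r /rho divfK// gt_eqF.
  by rewrite /p /tstar /= => ->; rewrite /T /tau; ring.
pose f x := pull t (kern m.+1) m x.
pose f' x := alpha * pw p (alpha + 1) (t m.-1 + x * T) * T.
pose V x := k * (1 - x) * (1 + r - x).
have df (x : R) : 0 <= x <= 1 -> is_derive x 1 f (f' x).
  move=> /andP[x0 x1].
  have xp : t m.-1 + x * T < p by rewrite -subr_gt0 pE mulr_gt0//; lra.
  have d1 := is_derive_pw alpha xp.
  have d2 : is_derive x 1 (fun x => t m.-1 + x * T) T.
    by apply: is_derive_eq; rewrite /GRing.scale/=; ring.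
  exact: (@is_derive1_comp R (pw p alpha) (fun x => t m.-1 + x * T) x _ _ d1 d2).
have cf : cont01 f by apply: cont_pull_kern; rewrite m0 ltnS leqnn.
have cf' : cont01 f'.
  have c1 : cont01 (fun x => pw p (alpha + 1) (t m.-1 + x * T)).
    by apply: cont01_pw; rewrite ?(ltW T0)//; have := pE 0; rewrite mul0r addr0 => ->; nra.
  by apply: cont01M; [exact: cont01Z|exact: cont01_cst].
(* [V' = -(1 - k (2x - 1))], and [K] vanishes at 0 through [f x - f 0] and at 1 through [V]. *)
pose K x := V x * (f x - f 0).
pose K' x := V x * f' x - (1 - k * (2 * x - 1)) * (f x - f 0).
have kr : k * (1 + r) = 1 by rewrite mulVf// gt_eqF// addr_gt0.
have dK (x : R) : 0 <= x <= 1 -> is_derive x 1 K (K' x).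
  move=> x01; have dfx := df x x01; rewrite /K /V; apply: is_derive_eq.
  rewrite /GRing.scale/= /K' /V.
  have -> : k * (1 - x) * (1 + r - x) * f' x - (1 - k * (2 * x - 1)) * (f x - f 0) =
     k * (1 - x) * (1 + r - x) * f' x - (k * (1 + r) - k * (2 * x - 1)) * (f x - f 0)
     by rewrite kr.
  ring.
have cV : cont01 V.
  apply: (@cont01_derive _ _ (fun x => k * (2 * x - 2 - r))) => x _.
  by rewrite /V; apply: is_derive_eq; rewrite /GRing.scale/=; ring.
have cfd : cont01 (fun x => f x - f 0).
  by apply: cont01D => //; apply: cont01N; exact: cont01_cst.
have cVf : cont01 (fun x => V x * f' x) by exact: cont01M.
have cT := @cont01_tilt R k _ cfd.
have cK : cont01 K' by apply: cont01D => //; exact: cont01N.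
have IK : \int01 K' = 0.
  by rewrite (int01_FTC cK dK) /K /V subrr mulr0 mul0r mul0r !subrr mulr0 subrr.
have -> : rise t (kern m.+1) m = \int01 (fun x => V x * f' x).
  have -> : \int01 (fun x => V x * f' x) = \int01 K' +
      \int01 (fun x => (1 - k * (2 * x - 1)) * (f x - f 0)).
    by rewrite -int01D//; apply: eq_int01 => x _; rewrite /K' subrK.
  by rewrite IK add0r -tiltE// tiltB_cst// /rise -(pull0 t).
have -> : dint r = \int01 (fun x => (1 - x) * (r + (1 - x)) / (sg * r + (1 - x))).
  rewrite /dint (@Rintegration_by_substitution_onem _ _ 1) ?lexx ?ler01//.
    by rewrite unstable.onem1.
  exact: cont01_dint_id.
have cD : cont01 (fun x => (1 - x) * (r + (1 - x)) / (sg * r + (1 - x))).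
  apply: (@cont01_dint r (fun x => 1 - x)) => // [x|s /andP[_ s1]]; last by rewrite subr_ge0.
  by apply: cvgB; [exact: cvg_cst|exact: cvg_id].
rewrite mulrA -int01Z//; apply: le_int01 => [//||x /andP[x0 x1]]; first exact: cont01Z.
rewrite /f' /V /pw pE; have -> : 1 + r - x = r + (1 - x) by ring.
by apply: weight_kern_le => //; rewrite subr_ge0.
Qed.

End Coefficients.

(** * Explicit bounds on the step ratios *)

Section Positivity.
Variable R : realType.

(** Young's inequality for [(1/r)^a * 1] with exponents [1/a] and [1/(1 - a)]. *)
Lemma powRN_le (r a : R) : 0 < r -> 0 < a < 1 -> (r `^ a)^-1 <= 1 - a + a / r.
Proof.
move=> r0 /andP[a0 a1].
have := @conjugate_powR R ((r^-1) `^ a) 1 a^-1 (1 - a)^-1.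
rewrite powR_ge0 ler01 !invr_gt0 a0 subr_gt0 a1 !invrK => /(_ isT isT isT isT).
have -> : a + (1 - a) = 1 by ring.
have -> : (r^-1 `^ a) `^ a^-1 = r^-1.
  by rewrite -powRrM mulfV ?gt_eqF// powRr1// invr_ge0 ltW.
have -> : r^-1 `^ a = (r `^ a)^-1.
  by rewrite -[r^-1]powR_inv1 ?(ltW r0)// -powRrM mulN1r powRN.
by move=> /(_ erefl); rewrite powR1; lra.
Qed.

(** [7/20] is a rational lower bound for the root: the equation reads [r (1 + r) (1 + 3 r) = 1], and
    at [7/20] the left side is still below 1. *)
Lemma rho_star_gt (r : R) : 0 < r -> r * (1 + r) = 1 - 3 * r ^+ 2 * (1 + r) -> r^-1 < 20 / 7.
Proof.
move=> r0 e; have rl : 7 / 20 < r by rewrite ltNge; apply/negP => rl; nra.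
have -> : 20 / 7 = (7 / 20)^-1 :> R by field.
by rewrite ltf_pV2 ?posrE//; lra.
Qed.

(** With [y = r^2 (1 + r)]: below [eta] one has [3 y < 1], and inverting the mesh bound gives
    [1/y - 3 <= 1/q]; from [eta] on, [y >= 1/3]. *)
Lemma mesh_ratio (eta r q : R) : 0 < eta -> 1 - 3 * eta ^+ 2 * (1 + eta) = 0 ->
  0 < r -> 0 < q ->
  (r < eta -> q <= r ^+ 2 * (1 + r) / (1 - 3 * r ^+ 2 * (1 + r))) ->
  (r ^+ 2 * (1 + r))^-1 <= 3 + q^-1.
Proof.
move=> eta0 e r0 q0 h; set y := r ^+ 2 * (1 + r).
have y0 : 0 < y by rewrite mulr_gt0 ?exprn_gt0 ?addr_gt0.
have q'0 : 0 < q^-1 by rewrite invr_gt0.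
have [rlt|rge] := ltP r eta.
  have y3 : 0 < 1 - 3 * y.
    rewrite -e -mulrA ltrD2l ltrN2 ltr_pM2l ?ltr0n// /y.
    by rewrite ltr_pM// ?exprn_ge0 ?addr_ge0 ?(ltW r0) ?ltrD2l// ltr_pXn2r// nnegrE ltW.
  have := h rlt; rewrite -[3 * r ^+ 2 * _]mulrA -/y => hq.
  have : (y / (1 - 3 * y))^-1 <= q^-1 by rewrite lef_pV2 ?posrE// divr_gt0.
  rewrite invf_div; suff -> : (1 - 3 * y) / y = y^-1 - 3 by lra.
  by field; rewrite gt_eqF.
have ye : eta ^+ 2 * (1 + eta) <= y.
  rewrite /y ler_pM ?exprn_ge0 ?addr_ge0 ?(ltW eta0) ?lerD2l//.
  by rewrite ler_pXn2r// nnegrE ltW.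
have : y^-1 <= 3 by rewrite -[leLHS]mul1r ler_pdivrMr// ; move: e; rewrite -mulrA; lra.
lra.
Qed.

End Positivity.

(** * The quadratic form of the scheme *)

Section QuadraticForm.
Variables (R : realType) (t : nat -> R) (alpha : R).
Hypothesis ht : forall j, t j < t j.+1.
Hypothesis halpha : 0 < alpha < 1.
Hypothesis hratio : forall l, (0 < l)%N ->
  (rho t l.+1 ^+ 2 * (1 + rho t l.+1))^-1 <= 3 + (rho t l.+2)^-1.
Local Notation sg := (sig alpha).
Local Notation kern := (kern t alpha).

(** [(1 - alpha) * slack m] is what [gcoef] subtracts for [1 < m < n]; [slack m] itself is the bound
    of [rise_kern_le]. *)
Definition slack m : R := ((sg * tau t m) `^ alpha)^-1 *
  (alpha / ((1 + rho t m.+1) * rho t m.+1 `^ alpha) * dint alpha (rho t m.+1)).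

(* [(1 - alpha) *: form_coef n] is the matrix of
   [2 * Gamma (2 - alpha) * Bn - \sum_k gcoef k * |delta_k u|^2]. *)
Definition form_coef n k j : R :=
  if j == 0%N then 0 else
  if j == k then
    if k == 1%N then kern 2 (t 1%N)
    else ccoef alpha t k k.-1 + kern k (t k.-1) + (if (k < n)%N then slack k else 0)
  else dcoef alpha t k j.

Lemma form_coef_lt n m i : (i < m)%N -> form_coef n m i = dcoef alpha t m i.
Proof. by move=> im; rewrite /form_coef (ltn_eqF im); case: i im => //= _; rewrite dcoef0. Qed.

Lemma form_coef_diff n m i : (0 < i < m)%N ->
  form_coef n m i - form_coef n m i.-1 = rise t (kern m) i + jump t (kern m) i.
Proof.
move=> im; rewrite -(dcoef_diff ht halpha)//; case/andP: im => i0 im.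
by rewrite !form_coef_lt// (leq_ltn_trans (leq_pred i)).
Qed.

Lemma form_coef_diag n m : (1 < m)%N ->
  form_coef n m m - form_coef n m m.-1 =
    jump t (kern m) m + (if (m < n)%N then slack m else 0).
Proof.
move=> m1; rewrite -(dcoef_last ht halpha)// (@form_coef_lt n m m.-1); last by case: m m1.
by rewrite /form_coef eqxx (gtn_eqF m1) gtn_eqF ?(ltnW m1)//; ring.
Qed.

Lemma kern_cvxS m : (0 < m)%N -> cvx_ndecr (t m.-1) (kern m.+1).
Proof. by case: m => // m _; apply: kern_cvx_le. Qed.

(** [jump] is linear in the kernel, and the difference of consecutive kernels is again convex,
    nondecreasing and nonnegative, so [jump_ge0] applies to it. *)
Lemma jump_kern_le m i : (0 < i <= m)%N -> jump t (kern m.+1) i <= jump t (kern m) i.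
Proof.
move=> /andP[i0 im]; have m0 := leq_trans i0 im.
have iB : t i.-1 <= t m.-1 by rewrite mesh_le// -!subn1 leq_sub2r.
rewrite -subr_ge0 -[jump _ (kern m.+1) i]mul1r.
rewrite -(jump_lin ht _ (kern_cvx ht halpha m0) (kern_cvxS m0))//.
apply: (jump_ge0 ht hratio (kern_diff_cvx ht halpha _ m0)) => // [|s sB].
  by rewrite lexx ler01.
by apply: (kern_diff_ge0 ht halpha); rewrite ?lexx ?ler01.
Qed.

Lemma rise_kern_diff m i : (0 < i < m)%N -> rise t (kern m.+1) i <= rise t (kern m) i.
Proof.
move=> /andP[i0 im]; have m0 := ltn_trans i0 im.
have iB : t i <= t m.-1 by rewrite mesh_le// -ltnS prednK.
rewrite -subr_ge0 -[rise _ (kern m.+1) i]mul1r.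
rewrite -(rise_lin ht _ (kern_cvx ht halpha m0) (kern_cvxS m0))//.
apply: (rise_ge0 ht (kern_diff_cvx ht halpha _ m0)) => //.
by rewrite lexx ler01.
Qed.

Lemma form_coef_mono n i m : (0 < i <= m)%N -> (m < n)%N ->
  form_coef n m.+1 i - form_coef n m.+1 i.-1 <= form_coef n m i - form_coef n m i.-1.
Proof.
move=> /andP[i0 ilem] mn.
rewrite [leLHS]form_coef_diff; last by rewrite i0 ltnS.
move: ilem; rewrite leq_eqVlt => /predU1P[eim|iltm]; last first.
  rewrite [leRHS]form_coef_diff; last by rewrite i0.
  by apply: lerD; [apply: rise_kern_diff|apply: jump_kern_le]; rewrite i0// ltnW.
have [m1|m1] := ltnP 1 m.
  (* Row [m] stops at its diagonal, so there is no [rise] of [kern m] to compare with; [slack m]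
     takes its place. *)
  rewrite eim [leRHS]form_coef_diag// mn addrC; apply: lerD.
    by apply: jump_kern_le; rewrite leqnn ltnW.
  exact: (rise_kern_le ht halpha (ltnW m1)).
have {m1}m1 : m = 1%N by apply/eqP; rewrite eqn_leq m1 -eim.
(* The first diagonal entry is the right-end value of the kernel of row 2, which dominates its
   tilted mean over subinterval 1. *)
rewrite eim m1 /form_coef/= subr0 /rise/= subrK.
by apply: (tilt_pull_le ht (kern_cvx ht halpha _)).
Qed.

Lemma form_coef_last n i : (0 < i <= n)%N -> form_coef n n i.-1 <= form_coef n n i.
Proof.
move=> /andP[i0 ilen]; have n0 := leq_trans i0 ilen; rewrite -subr_ge0.
have jump0 : 0 <= jump t (kern n) i.
  apply: (jump_ge0 ht hratio (kern_cvx ht halpha n0)) => [s _|]; first exact: kern_ge0.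
  by rewrite mesh_le// -!subn1 leq_sub2r.
move: ilen; rewrite leq_eqVlt => /predU1P[ein|iltn]; last first.
  rewrite form_coef_diff ?i0// addr_ge0//.
  apply: (rise_ge0 ht (kern_cvx ht halpha n0)) => //.
  by rewrite mesh_le// -ltnS prednK.
have [n1|n1] := ltnP 1 n; first by rewrite ein form_coef_diag// ltnn addr0 -{2}ein.
have -> : i = 1%N by apply/eqP; rewrite eqn_leq i0 ein n1.
have -> : n = 1%N by apply/eqP; rewrite eqn_leq n0 n1.
by rewrite /form_coef/= subr0 kern_ge0.
Qed.

Lemma form_coef_gcoef n k : (0 < k <= n)%N ->
  (1 - alpha) * form_coef n k k =
  2 * (1 - alpha) * ccoef alpha t k k.-1 + 2 * sg * ((sg * tau t k) `^ alpha)^-1 -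
  gcoef alpha t n k.
Proof.
move=> /andP[k0 kn]; rewrite /form_coef eqxx gtn_eqF// /gcoef.
have s0 := sig_gt0 halpha; have T0 := tau_gt0 ht k0.
have -> : 2 * sg = 2 - alpha by rewrite /sig; field.
case: eqVneq => [->|k1].
  rewrite ccoef0 mulr0 add0r -[t 1%N]/(t 2.-1) kernE//.
  have T1 : 0 < tau t 1 by rewrite tau_gt0.
  have -> : sg * tau t 2 = sg * tau t 1 * rho t 2.
    by rewrite /rho/=; field; rewrite gt_eqF.
  have r2 : 0 <= rho t 2 by rewrite ltW// rho_gt0.
  by rewrite (powRM _ (mulr_ge0 (ltW s0) (ltW T1)) r2) invfM; ring.
rewrite kernE//; case: eqVneq => [ekn|nkn].
  by rewrite [in X in (X < _)%N]ekn ltnn addr0; ring.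
rewrite ltn_neqAle nkn kn/= /slack -/(dint alpha (rho t k.+1)).
move: (dint _ _) ((_ * _ `^ _)^-1) ((_ `^ _)^-1) => D E Q; ring.
Qed.

Lemma gcoef_gt0 n k : (0 < k <= n)%N -> (forall j, (1 < j)%N -> (rho t j)^-1 < 20 / 7) ->
  0 < gcoef alpha t n k.
Proof.
move=> /andP[k0 kn] hrho; have [alpha0 alpha1] := andP halpha.
have s0 := sig_gt0 halpha; have T0 := tau_gt0 ht k0.
have Q0 : 0 < ((sg * tau t k) `^ alpha)^-1 by rewrite invr_gt0 powR_gt0// mulr_gt0.
have cg0 : 0 <= (1 - alpha) * ccoef alpha t k k.-1.
  by rewrite mulr_ge0 ?ccoef_ge0// subr_ge0 ltW.
(* By [powRN_le], with [13/7 = 20/7 - 1]. *)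
have pow_le j : (1 < j)%N -> 0 <= (rho t j `^ alpha)^-1 <= 1 + 13 / 7 * alpha.
  move=> j1; have r0 := rho_gt0 ht j1; rewrite invr_ge0 powR_ge0/=.
  apply: le_trans (powRN_le r0 halpha) _.
  have := hrho j j1; move: (rho t j)^-1 => q; nra.
rewrite /gcoef; case: eqVneq => [ek|k1].
  move: Q0; rewrite ek => Q0; rewrite mulr_gt0// subr_gt0.
  have /andP[p0] := pow_le 2 isT; move: (rho t 2 `^ alpha)^-1 p0 => p p0 ple.
  have -> : 2 * sg = 2 - alpha by rewrite /sig; field.
  (* It suffices that [13/7 * alpha (1 - alpha) < 1]. *)
  nra.
case: eqVneq => [_|_]; first by rewrite ltr_wpDl.
rewrite ltr_wpDl// mulr_gt0// subr_gt0 -/(dint alpha (rho t k.+1)).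
have r0 : 0 < rho t k.+1 by rewrite rho_gt0.
have D1 := dint_le1 halpha r0.
have /andP[p0 ple] := pow_le k.+1 k0.
have R1 : 0 <= (1 + rho t k.+1)^-1 <= 1 by apply: kappa01.
rewrite invfM; move: (dint _ _) D1 (_^-1) R1 (_^-1) p0 ple => D D1 q /andP[q0 q1] p p0 ple.
(* The subtracted quantity is at most [1/4 * 20/7 = 5/7]. *)
have X0 : 0 <= alpha * (1 - alpha) by rewrite mulr_ge0 ?subr_ge0 ?(ltW alpha0) ?(ltW alpha1).
have X1 : alpha * (1 - alpha) <= 4^-1.
  rewrite -subr_ge0 (_ : _ - _ = (alpha - 2^-1) ^+ 2) ?sqr_ge0//; by field.
have Y0 : 0 <= q * p by rewrite mulr_ge0.
have Y1 : q * p <= 20 / 7 by rewrite -[leRHS]mul1r ler_pM//; lra.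
have XD : alpha * (1 - alpha) * (q * p) * D <= alpha * (1 - alpha) * (q * p).
  by rewrite -[leRHS]mulr1 ler_wpM2l// mulr_ge0.
have XY : alpha * (1 - alpha) * (q * p) <= 4^-1 * (20 / 7) by rewrite ler_pM.
lra.
Qed.

End QuadraticForm.

(** As [c_0 = 0], the separate term [-a_1] is [d_1] and joins the sum. *)
Lemma ip_Lstar (R : realType) (V : lmodType R) (ip : V -> V -> R)
    (hip : is_inner_product ip) (alpha : R) (t : nat -> R) (u : nat -> V) (k : nat) :
  (0 < k)%N ->
  ip (Lstar alpha t u k) (delta u k) =
  (Gamma (1 - alpha))^-1 * (ccoef alpha t k k.-1 * ip (delta u k) (delta u k) +
     \sum_(1 <= j < k) dcoef alpha t k j * ip (delta u j) (delta u k)) +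
  sig alpha `^ (1 - alpha) / (Gamma (2 - alpha) * tau t k `^ alpha) *
    ip (delta u k) (delta u k).
Proof.
move=> k0; rewrite /Lstar; move: (delta u) => x.
rewrite (ipDl hip) !(ipZl hip) !(ipDl hip) (ip_suml hip).
rewrite -scaleNr !(ipZl hip); congr (_ * _ + _); rewrite -addrA; congr (_ + _).
under eq_bigr do rewrite (ipZl hip).
(* For [k = 1] the sum is empty and [acoef] takes its default value 0. *)
case: k k0 => [|[|k]]// _; first by rewrite /acoef/= oppr0 mul0r add0r !big_geq.
by rewrite [RHS]big_ltn// /dcoef ccoef0 sub0r.
Qed.

Lemma powR_split (R : realType) (s T alpha : R) : 0 < s -> 0 < T ->
  s `^ (1 - alpha) / T `^ alpha = s * ((s * T) `^ alpha)^-1.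
Proof.
move=> s0 T0; rewrite powRM ?(ltW s0) ?(ltW T0)// invfM mulrA.
by rewrite powRD ?(gt_eqF s0) ?implybT// powRr1 ?(ltW s0)// powRN.
Qed.

(** [GammaS] brings the history and local terms over one factor; diagonal entries then agree by
    [form_coef_gcoef], the others by [form_coef_lt]. *)
Lemma Bn_eq (R : realType) (V : lmodType R) (ip : V -> V -> R)
    (hip : is_inner_product ip) (alpha : R) (halpha : 0 < alpha < 1)
    (t : nat -> R) (ht : forall j, t j < t j.+1) (u : nat -> V) (n : nat) :
  Bn ip alpha t u n = \sum_(1 <= k < n.+1)
      gcoef alpha t n k / (2 * Gamma (2 - alpha)) * ip (delta u k) (delta u k) +
    (1 - alpha) / (2 * Gamma (2 - alpha)) *
      quad_form ip (form_coef t alpha n) (delta u) n.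
Proof.
have [alpha0 alpha1] := andP halpha.
have [GS G20] : Gamma (2 - alpha) = (1 - alpha) * Gamma (1 - alpha) /\ 0 < Gamma (2 - alpha).
  have -> : 2 - alpha = 1 - alpha + 1 by ring.
  by apply: GammaS; apply/andP; split; lra.
have G10 : 0 < Gamma (1 - alpha).
  by move: G20; rewrite GS pmulr_rgt0// subr_gt0.
rewrite /Bn /quad_form mulr_sumr -big_split/=; apply: eq_big_nat => k kn.
have k0 : (0 < k)%N by case/andP: kn.
rewrite (ip_Lstar hip)//.
have -> : \sum_(1 <= j < k) form_coef t alpha n k j * ip (delta u j) (delta u k) =
    \sum_(1 <= j < k) dcoef alpha t k j * ip (delta u j) (delta u k).
  by apply: eq_big_nat => j /andP[_ jk]; rewrite form_coef_lt.
have -> : sig alpha `^ (1 - alpha) / (Gamma (2 - alpha) * tau t k `^ alpha) =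
    (Gamma (2 - alpha))^-1 * (sig alpha * ((sig alpha * tau t k) `^ alpha)^-1).
  by rewrite invfM mulrCA (powR_split _ (sig_gt0 halpha) (tau_gt0 ht k0)).
have := form_coef_gcoef ht halpha kn.
move: (\sum_(_ <= _ < _) _) (ip _ _) ((_ `^ _)^-1) (form_coef _ _ _ _ _) => X Y Q f.
move: (gcoef _ _ _ _) (ccoef _ _ _ _) => g c fg.
have -> : g = 2 * (1 - alpha) * c + 2 * sig alpha * Q - (1 - alpha) * f by rewrite fg; ring.
rewrite GS; move: (sig alpha) (Gamma _) G10 => s G G0; field.
by rewrite !gt_eqF ?subr_gt0.
Qed.

Unset Implicit Arguments.

Theorem theorem1 (R : realType) (V : lmodType R) (ip : V -> V -> R)
  (hip : is_inner_product ip)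
  (alpha : R) (halpha : 0 < alpha < 1)
  (rho_star eta : R)
  (hrs : 0 < rho_star)
  (hrs_root : rho_star * (1 + rho_star) = 1 - 3 * rho_star ^+ 2 * (1 + rho_star))
  (heta : 0 < eta)
  (heta_root : 1 - 3 * eta ^+ 2 * (1 + eta) = 0)
  (t : nat -> R) (ht0 : t 0%N = 0) (ht : forall j, t j < t j.+1)
  (hmesh : forall k : nat, (2 <= k)%N ->
     [/\ rho_star < rho t k,
         rho_star < rho t k.+1
       & rho t k < eta ->
         rho t k.+1 <= rho t k ^+ 2 * (1 + rho t k) /
                         (1 - 3 * rho t k ^+ 2 * (1 + rho t k))]) :
  forall (u : nat -> V) (n : nat), (1 <= n)%N ->
    [/\ Bn ip alpha t u n >=
          \sum_(1 <= k < n.+1)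
             gcoef alpha t n k / (2 * Gamma (2 - alpha)) * ip (delta u k) (delta u k),
        \sum_(1 <= k < n.+1)
             gcoef alpha t n k / (2 * Gamma (2 - alpha)) * ip (delta u k) (delta u k) >= 0
      & forall k : nat, (1 <= k <= n)%N -> 0 < gcoef alpha t n k].
Proof.
have hrho j : (1 < j)%N -> rho_star < rho t j by move=> /hmesh[].
(* From here on [rho_star] acts only through the rational bound [20/7]. *)
have hinv j : (1 < j)%N -> (rho t j)^-1 < 20 / 7.
  move=> j1; apply: lt_trans (rho_star_gt hrs hrs_root).
  by rewrite ltf_pV2 ?posrE ?hrho// (lt_trans hrs)// hrho.
have hratio l : (0 < l)%N ->
    (rho t l.+1 ^+ 2 * (1 + rho t l.+1))^-1 <= 3 + (rho t l.+2)^-1.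
  move=> l0; have [r1 r2 h] := hmesh l.+1 l0.
  by apply: (mesh_ratio heta heta_root _ _ h); apply: lt_trans hrs _.
have [alpha0 alpha1] := andP halpha.
have G20 : 0 < 2 * Gamma (2 - alpha).
  have -> : 2 - alpha = 1 - alpha + 1 by ring.
  by rewrite mulr_gt0//; apply: (@GammaS _ _ _).2; apply/andP; split; lra.
move=> u n n1.
have g0 k : (1 <= k <= n)%N -> 0 < gcoef alpha t n k.
  by move=> kn; apply: (gcoef_gt0 ht halpha kn hinv).
split=> //.
- rewrite (Bn_eq hip halpha ht) lerDl mulr_ge0//.
    by rewrite divr_ge0 ?(ltW G20)// subr_ge0 ltW.
  exact: (quad_form_ge0 hip (delta u) (fun k => erefl)
    (fun i m im mn => form_coef_mono ht halpha hratio im mn)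
    (fun i => @form_coef_last _ _ _ ht halpha hratio n i)).
- rewrite big_nat sumr_ge0// => k kn; rewrite mulr_ge0 ?(ip_ge0 hip)//.
  by rewrite divr_ge0 ?(ltW G20)// ltW// g0.
Qed.
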